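(* Let $A$ and $B$ be finite dimensional Morita equivalent algebras over a field $k$, and suppose that $B$ has one or more of the following properties (some of which require a positive grading on $B$): quasi-hereditary, positively graded, Koszul, standard Koszul, Q-Koszul, standard Q-Koszul. Then $A$ has the corresponding property or properties (for those that require a grading: with respect to a suitable positive grading on $A$). Moreover, when $B$ is given with a positive grading, after giving $A$ an appropriate positive grading the categories $A\text{-grmod}$ and $B\text{-grmod}$ are equivalent by a graded functor.
   Context: Morita equivalent means that the module categories are equivalent ($k$-linearly). A positive grading on an algebra $A$ is a decomposition $A=\bigoplus_{n\ge 0}A_n$ with $A_iA_j\subseteq A_{i+j}$; $A_0$ need not be semisimple. $A\text{-mod}$ is the category of finite dimensional left $A$-modules; for $A$ graded, $A\text{-grmod}$ is the category of finite dimensional $\mathbb Z$-graded left $A$-modules with degree-preserving maps. $M\langle r\rangle$ denotes the shift $M\langle r\rangle_i:=M_{i-r}$. A functor $F:B\text{-grmod}\to A\text{-grmod}$ is graded if it is additive and commutes with all shifts $\langle r\rangle$ up to natural isomorphism. $\mathrm{ext}^n_A$ denotes $\mathrm{Ext}^n$ computed in $A\text{-grmod}$. $\Lambda$ denotes a finite set indexing the isomorphism classes of irreducible $A$-modules; when $A$ is positively graded it also indexes the irreducible $A_0$-modules. When the Q-Koszul and standard Q-Koszul properties are discussed, algebras are assumed split over $k$ (irreducible modules are absolutely irreducible). Koszul: $A$ is positively graded, $A_0$ is semisimple, and every irreducible module, placed in grade 0, is linear, i.e. has a graded projective resolution $P_\bullet$ in which the head of $P_i$ is concentrated in grade $i$.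 Standard Koszul: $A$ is Koszul and quasi-hereditary, each standard module $\Delta(\lambda)$ (graded with head in grade 0) is linear in the same sense, and, dually, each costandard module $\nabla(\lambda)$ (graded with socle in grade 0) has a graded injective resolution $I^\bullet$ in which the socle of $I^i$ is concentrated in grade $-i$. Q-Koszul: $A$ is positively graded, there is a poset structure on $\Lambda$ with respect to which $A_0$ is quasi-hereditary, and, with $\Delta_0(\lambda)$ and $\nabla^0(\lambda)$ the standard and costandard $A_0$-modules regarded (through $A\to A/A_{>0}\cong A_0$) as graded $A$-modules concentrated in grade 0, for all integers $i>0$, all $j\in\mathbb Z$ and all $\lambda,\mu\in\Lambda$: $\mathrm{ext}^i_A(\Delta_0(\lambda),\nabla^0(\mu)\langle j\rangle)\neq 0\implies i=j$. Standard Q-Koszul: $A$ is positively graded and quasi-hereditary with weight poset $\Lambda$; let $\Delta(\lambda)$ be the standard module graded with head in grade 0, $\nabla(\lambda)$ the costandard module graded with socle in grade 0, and let $\Delta^0(\lambda)$, $\nabla_0(\lambda)$ be their grade 0 components (these are the standard and costandard modules of the quasi-hereditary algebra $A_0$), regarded as graded $A$-modules in grade 0. It is required that for all $\lambda,\mu\in\Lambda$ and all integers $n,r$: (a) $\mathrm{ext}^n_A(\Delta(\lambda),\nabla_0(\mu)\langle r\rangle)\ne0\implies n=r$; (b) $\mathrm{ext}^n_A(\Delta^0(\mu),\nabla(\lambda)\langle r\rangle)\neq0\implies n=r$. *)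

(* Defs.v *)
From HB Require Import structures.
From Stdlib Require ProofIrrelevance.
From mathcomp Require Import all_boot all_order all_algebra falgebra.

Set Implicit Arguments.
Unset Strict Implicit.
Unset Printing Implicit Defensive.

Import Order.TTheory GRing.Theory.
Local Open Scope ring_scope.

(* Objects have an underlying finite dimensional k-space, morphisms are those
   k-linear maps that satisfy [is_mor]. *)
Record lincat (k : fieldType) := LinCat {
  obj :> Type;
  car : obj -> vectType k;
  is_mor : forall X Y : obj, 'Hom(car X, car Y) -> Prop;
  is_mor_id : forall X, @is_mor X X \1%VF;
  is_mor_comp : forall X Y Z g f,
    @is_mor Y Z g -> @is_mor X Y f -> @is_mor X Z (g \o f)%VF;
  is_mor_lin : forall X Y c f g,
    @is_mor X Y f -> @is_mor X Y g -> @is_mor X Y (c *: f + g)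
}.
Arguments is_mor {k l X Y} f.

Record mor (k : fieldType) (C : lincat k) (X Y : C) := Mor {
  mfun :> 'Hom(car X, car Y);
  morP : is_mor mfun
}.

Section Categories.
Variables (k : fieldType) (C : lincat k).
Implicit Types X Y Z : C.

Fact mor_eq X Y (f g : mor X Y) : mfun f = mfun g -> f = g.
Proof.
case: f g => [f fP] [g gP] /= fg; case: _ / fg gP => gP.
by rewrite (ProofIrrelevance.proof_irrelevance _ fP gP).
Qed.

Definition idm X : mor X X := Mor (is_mor_id X).

Definition compm X Y Z (g : mor Y Z) (f : mor X Y) : mor X Z :=
  Mor (is_mor_comp (morP g) (morP f)).

Definition linm X Y (c : k) (f g : mor X Y) : mor X Y :=
  Mor (is_mor_lin c (morP f) (morP g)).

Definition is_iso X Y (f : mor X Y) : Prop :=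
  exists g : mor Y X, compm g f = idm X /\ compm f g = idm Y.

Definition isomorphic X Y : Prop := exists f : mor X Y, is_iso f.

Definition inj_mor X Y (f : mor X Y) : Prop := lker f = 0%VS.
Definition surj_mor X Y (f : mor X Y) : Prop := limg f = fullv.
Definition exact_at X Y Z (f : mor X Y) (g : mor Y Z) : Prop := limg f = lker g.
Definition short_exact X Y Z (f : mor X Y) (g : mor Y Z) : Prop :=
  [/\ inj_mor f, exact_at f g & surj_mor g].

Definition projective (P : C) : Prop :=
  forall X Y (e : mor X Y) (f : mor P Y), surj_mor e ->
  exists h : mor P X, f = compm e h.

Definition injective_obj (I : C) : Prop :=
  forall X Y (e : mor X Y) (f : mor X I), inj_mor e ->
  exists h : mor Y I, f = compm h e.

Record proj_resolution X := ProjResolution {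
  pobj :> nat -> C;
  pdiff : forall n, mor (pobj n.+1) (pobj n);
  paug : mor (pobj 0) X;
  pobj_proj : forall n, projective (pobj n);
  paug_surj : surj_mor paug;
  paug_exact : exact_at (pdiff 0) paug;
  pdiff_exact : forall n, exact_at (pdiff n.+1) (pdiff n)
}.

Record inj_resolution X := InjResolution {
  iobj :> nat -> C;
  idiff : forall n, mor (iobj n) (iobj n.+1);
  icoaug : mor X (iobj 0);
  iobj_inj : forall n, injective_obj (iobj n);
  icoaug_inj : inj_mor icoaug;
  icoaug_exact : exact_at icoaug (idiff 0);
  idiff_exact : forall n, exact_at (idiff n) (idiff n.+1)
}.

Definition cocycle X (P : proj_resolution X) Y n (z : mor (P n) Y) : Prop :=
  (z \o pdiff P n)%VF = 0.

Definition coboundary X (P : proj_resolution X) Y n : mor (P n) Y -> Prop :=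
  match n with
  | 0 => fun z => mfun z = 0
  | m.+1 => fun z => exists h : mor (P m) Y, z = compm h (pdiff P m)
  end.

(* Ext^n(X, Y) <> 0, where Ext^n(X, Y) is the n-th cohomology of Mor(P, Y). *)
Definition ext_neq0 n X Y : Prop :=
  exists (P : proj_resolution X) (z : mor (P n) Y),
    cocycle z /\ ~ coboundary z.

(* For irreducible S, this says that S is a composition factor of X. *)
Definition subquotient S X : Prop :=
  exists (Y : C) (i : mor Y X) (p : mor Y S), inj_mor i /\ surj_mor p.

Inductive filtered_by (S : C -> Prop) : C -> Prop :=
| filtered_zero X : fullv = 0%VS :> {vspace car X} -> filtered_by S X
| filtered_ext X Y Z (f : mor X Y) (g : mor Y Z) :
    short_exact f g -> filtered_by S X -> S Z -> filtered_by S Y.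

End Categories.

Arguments idm {k C} X.

Record functor (k : fieldType) (C D : lincat k) := Functor {
  fobj :> C -> D;
  fmor : forall X Y, mor X Y -> mor (fobj X) (fobj Y);
  fmor_id : forall X, fmor (idm X) = idm (fobj X);
  fmor_comp : forall X Y Z (g : mor Y Z) (f : mor X Y),
    fmor (compm g f) = compm (fmor g) (fmor f)
}.
Arguments fmor {k C D} f {X Y} : rename.

Section Functors.
Variable k : fieldType.
Implicit Types C D E : lincat k.

Definition id_functor C : functor C C :=
  @Functor k C C id (fun _ _ => id) (fun _ => erefl) (fun _ _ _ _ _ => erefl).

Fact comp_functor_id C D E (G : functor D E) (F : functor C D) X :
  fmor G (fmor F (idm X)) = idm (G (F X)).
Proof. by rewrite !fmor_id. Qed.

Fact comp_functor_comp C D E (G : functor D E) (F : functor C D) X Y Z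
    (g : mor Y Z) (f : mor X Y) :
  fmor G (fmor F (compm g f)) =
  compm (fmor G (fmor F g)) (fmor G (fmor F f)).
Proof. by rewrite !fmor_comp. Qed.

Definition comp_functor C D E (G : functor D E) (F : functor C D) :
    functor C E :=
  @Functor k C E (fun X => G (F X)) (fun _ _ f => fmor G (fmor F f))
    (comp_functor_id G F) (@comp_functor_comp C D E G F).

Definition nat_iso C D (F G : functor C D) : Prop :=
  exists eta : forall X, mor (F X) (G X),
    (forall X, is_iso (eta X)) /\
    (forall X Y (f : mor X Y),
       compm (eta Y) (fmor F f) = compm (fmor G f) (eta X)).

Definition equivalence C D (F : functor C D) : Prop :=
  exists G : functor D C,
    nat_iso (comp_functor G F) (id_functor C) /\
    nat_iso (comp_functor F G) (id_functor D).

Definition linear_functor C D (F : functor C D) : Prop :=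
  forall X Y c (f g : mor X Y),
    fmor F (linm c f g) = linm c (fmor F f) (fmor F g).

Definition additive_functor C D (F : functor C D) : Prop :=
  forall X Y (f g : mor X Y),
    fmor F (linm 1 f g) = linm 1 (fmor F f) (fmor F g).

End Functors.

Record module (k : fieldType) (A : falgType k) := Module {
  mcar :> vectType k;
  mact : A -> 'End(mcar);
  mact_linear : linear mact;
  mact1 : mact 1 = \1%VF;
  mactM : forall a b, mact (a * b) = (mact a \o mact b)%VF
}.
Arguments mact {k A} M a : rename.

Lemma mact0 (k : fieldType) (A : falgType k) (M : module A) : mact M 0 = 0.
Proof. by rewrite -[0 in LHS](addNr 0) -scaleN1r mact_linear scaleN1r addNr. Qed.

Section ModuleCategory.
Variables (k : fieldType) (A : falgType k).
Implicit Types M N P : module A.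

Definition is_modmor M N (f : 'Hom(M, N)) : Prop :=
  forall a m, f (mact M a m) = mact N a (f m).

Fact is_modmor_id M : @is_modmor M M \1%VF.
Proof. by move=> a m; rewrite !id_lfunE. Qed.

Fact is_modmor_comp M N P (g : 'Hom(N, P)) (f : 'Hom(M, N)) :
  is_modmor g -> is_modmor f -> is_modmor (g \o f)%VF.
Proof. by move=> gP fP a m; rewrite !comp_lfunE fP gP. Qed.

Fact is_modmor_lin M N c (f g : 'Hom(M, N)) :
  is_modmor f -> is_modmor g -> is_modmor (c *: f + g).
Proof.
by move=> fP gP a m; rewrite !add_lfunE !scale_lfunE fP gP linearD linearZ.
Qed.

Canonical modcat : lincat k :=
  LinCat is_modmor_id is_modmor_comp is_modmor_lin.

Definition submodule M (U : {vspace M}) : Prop :=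
  forall a m, m \in U -> mact M a m \in U.

Definition irreducible M : Prop :=
  fullv <> 0%VS :> {vspace M} /\
  forall U : {vspace M}, submodule U -> U = 0%VS \/ U = fullv.

Definition simple_submodule M (U : {vspace M}) : Prop :=
  [/\ submodule U, U <> 0%VS &
      forall W : {vspace M}, submodule W -> (W <= U)%VS -> W = 0%VS \/ W = U].

Definition maximal_submodule M (U : {vspace M}) : Prop :=
  [/\ submodule U, U <> fullv &
      forall W : {vspace M}, submodule W -> (U <= W)%VS -> W = U \/ W = fullv].

Definition sub_rad M (W : {vspace M}) : Prop :=
  forall U : {vspace M}, maximal_submodule U -> (W <= U)%VS.

Definition soc_sub M (W : {vspace M}) : Prop :=
  forall U : {vspace M}, simple_submodule U -> (U <= W)%VS.

Definition semisimple M : Prop :=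
  exists n (S : 'I_n -> {vspace M}),
    [/\ forall i, simple_submodule (S i),
        directv (\sum_(i < n) S i) & (\sum_(i < n) S i)%VS = fullv].

(* For irreducible S, the kernel of such a p is exactly the radical of M. *)
Definition is_head M (S : module A) (p : mor M S) : Prop :=
  surj_mor p /\ sub_rad (lker p).

Definition is_socle M (S : module A) (i : mor S M) : Prop :=
  inj_mor i /\ soc_sub (limg i).

Definition regular_act (a : A) : 'End(A) := amull a.

Fact regular_act_linear : linear regular_act.
Proof. exact: linearP. Qed.

Fact regular_actM a b :
  regular_act (a * b) = (regular_act a \o regular_act b)%VF.
Proof. by apply/lfunP=> x; rewrite comp_lfunE !lfunE /= mulrA. Qed.

Definition regular : module A :=
  Module regular_act_linear (amull1 A) regular_actM.

Definition semisimple_algebra : Prop := semisimple regular.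

Definition act_mx M (a : A) : 'M[k]_(\dim {:M}) :=
  passmx.mxof (vbasis {:M}) (vbasis {:M}) (mact M a).

(* Irreducibility of the base change K (x) M for every field extension K of k.
   In coordinates K (x) M is the space of row vectors over K, and a K-subspace
   is a submodule iff it is stable under the image of A; subspaces are given as
   row spaces of square matrices. *)
Definition absolutely_irreducible M : Prop :=
  forall (K : fieldType) (iota : {rmorphism k -> K}),
    (0 < \dim {:M})%N /\
    forall U : 'M[K]_(\dim {:M}),
      (forall a, (U *m map_mx iota (act_mx M a) <= U)%MS) ->
      U = 0 \/ row_full U.

Definition split_algebra : Prop :=
  forall M, irreducible M -> absolutely_irreducible M.

Definition irr_index (Lam : Type) (L : Lam -> module A) : Prop :=
  [/\ forall lam, irreducible (L lam),
      forall lam mu, isomorphic (L lam) (L mu) -> lam = mu &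
      forall M, irreducible M -> exists lam, isomorphic M (L lam)].

Section Weights.
Variables (d : Order.disp_t) (Lam : finPOrderType d) (L : Lam -> module A).

(* The standard modules of a highest weight category (Cline-Parshall-Scott):
   head L(lam), the other composition factors L(mu) satisfy mu < lam, and the
   kernel of P(lam) -> Delta(lam) is filtered by Delta(nu) with nu > lam.  If a
   family with these properties exists, it is unique up to isomorphism. *)
Definition standard_family (D : Lam -> module A) : Prop :=
  forall lam,
    (exists (R : module A) (i : mor R (D lam)) (p : mor (D lam) (L lam)),
       [/\ short_exact i p, is_head p &
           forall mu, subquotient (L mu) R -> (mu < lam)%O]) /\
    (exists (P K : module A) (h : mor P (L lam))
            (i : mor K P) (q : mor P (D lam)),
       [/\ projective P, is_head h, short_exact i q &
           filtered_by
             (fun X => exists2 nu, (lam < nu)%O & isomorphic X (D nu)) K]).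

Definition costandard_family (N : Lam -> module A) : Prop :=
  forall lam,
    (exists (Q : module A) (i : mor (L lam) (N lam)) (p : mor (N lam) Q),
       [/\ short_exact i p, is_socle i &
           forall mu, subquotient (L mu) Q -> (mu < lam)%O]) /\
    (exists (I Q : module A) (s : mor (L lam) I)
            (j : mor (N lam) I) (p : mor I Q),
       [/\ injective_obj I, is_socle s, short_exact j p &
           filtered_by
             (fun X => exists2 nu, (lam < nu)%O & isomorphic X (N nu)) Q]).

End Weights.

Definition quasi_hereditary : Prop :=
  exists (d : Order.disp_t) (Lam : finPOrderType d) (L D : Lam -> module A),
    irr_index L /\ standard_family L D.

End ModuleCategory.

Definition morita_equivalent (k : fieldType) (A B : falgType k) : Prop :=
  exists F : functor (modcat A) (modcat B), linear_functor F /\ equivalence F.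

(* V is the internal direct sum of the W i; as V is finite dimensional, all but
   finitely many W i then vanish. *)
Definition decomposition (k : fieldType) (V : vectType k) (I : choiceType)
    (W : I -> {vspace V}) : Prop :=
  (forall s : seq I, uniq s -> directv (\sum_(i <- s) W i)) /\
  (exists s : seq I, (\sum_(i <- s) W i)%VS = fullv).

Record pos_grading (k : fieldType) (A : falgType k) := PosGrading {
  agr :> nat -> {vspace A};
  agr_dec : decomposition agr;
  agrM : forall i j a b, a \in agr i -> b \in agr j -> a * b \in agr (i + j)%N
}.

Section Decomposition.
Variables (k : fieldType) (V : vectType k) (I : choiceType).
Variable W : I -> {vspace V}.
Hypothesis decW : decomposition W.

Lemma decomposition_disjoint i (t : seq I) :
  uniq (i :: t) -> (W i :&: \sum_(j <- t) W j)%VS = 0%VS.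
Proof.
move=> uit; have /andP[_ ut] : (i \notin t) && uniq t by [].
have := proj1 decW _ uit; have := proj1 decW _ ut.
rewrite !directvE /= !big_cons => /eqP <- /eqP dit.
apply/eqP; rewrite -dimv_eq0 -(eqn_add2l (\dim (W i + \sum_(j <- t) W j))).
by rewrite dimv_sum_cap dit addn0.
Qed.

Lemma decomposition_ind (P : V -> Prop) :
    (forall i x, x \in W i -> P x) -> P 0 ->
    (forall x y, P x -> P y -> P (x + y)) -> forall x, P x.
Proof.
move=> PW P0 PD x; case: (proj2 decW) => s sV.
have: x \in (\sum_(i <- s) W i)%VS by rewrite sV memvf.
elim: s {sV} x => [|i s IH] x; first by rewrite big_nil memv0 => /eqP->.
rewrite big_cons => /memv_addP[u uW [v vs ->]].
by apply: PD; [apply: PW uW | apply: IH].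
Qed.

End Decomposition.

Section DegreeZero.
Variables (k : fieldType) (A : falgType k) (G : pos_grading A).

Fact agr_supp : exists t : seq nat,
  uniq (0%N :: t) && ((agr G 0 + \sum_(n <- t) agr G n)%VS == fullv).
Proof.
case: (proj2 (agr_dec G)) => s sV.
exists [seq n <- undup s | n != 0%N].
rewrite /= mem_filter eqxx /= filter_uniq ?undup_uniq //= eqEsubv subvf /=.
rewrite -sV big_seq; elim/big_rec: _ => [|n U ns UV]; first exact: sub0v.
rewrite subv_add UV andbT; case: (eqVneq n 0%N) => [->|n0]; first exact: addvSl.
apply: subv_trans (addvSr _ _).
have nt : n \in [seq n <- undup s | n != 0%N] by rewrite mem_filter n0 mem_undup.
by rewrite (big_rem _ nt) /=; apply: addvSl.
Qed.

Definition agr_pos : {vspace A} := (\sum_(n <- xchoose agr_supp) agr G n)%VS.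

(* The projection of A onto its grade 0 component along the others. *)
Definition pr0 : 'End(A) := daddv_pi (agr G 0) agr_pos.

Let t := xchoose agr_supp.
Let t_uniq : uniq (0%N :: t).
Proof. by case/andP: (xchooseP agr_supp). Qed.
Let t_full : (agr G 0 + agr_pos)%VS = fullv.
Proof. by case/andP: (xchooseP agr_supp) => _ /eqP. Qed.
Let disj : (agr G 0 :&: agr_pos)%VS = 0%VS.
Proof. exact: (decomposition_disjoint (agr_dec G) t_uniq). Qed.

Let pr0D a : pr0 a + daddv_pi agr_pos (agr G 0) a = a.
Proof. by apply: daddv_pi_add; rewrite ?t_full ?memvf. Qed.

Lemma pr0_mem a : pr0 a \in agr G 0.
Proof. exact: memv_pi. Qed.

Lemma pr0_id a : a \in agr G 0 -> pr0 a = a.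
Proof. by move=> a0; apply: daddv_pi_id. Qed.

Lemma pr0_posg n a : (0 < n)%N -> a \in agr G n -> pr0 a = 0.
Proof.
move=> n0 an; have aP : a \in agr_pos.
  have [nt|nt] := boolP (n \in t).
    by rewrite /agr_pos (big_rem _ nt) /=; apply: (subvP (addvSl _ _)).
  have u : uniq [:: n, 0%N & t] by rewrite [uniq _]/= inE negb_or -lt0n n0 nt.
  have := decomposition_disjoint (agr_dec G) u.
  rewrite big_cons -/agr_pos t_full capvf => an0.
  by move: an; rewrite an0 memv0 => /eqP->; rewrite mem0v.
have dis' : (agr_pos :&: agr G 0 = 0)%VS by rewrite capvC.
by have := pr0D a; rewrite (daddv_pi_id dis' aP) => /(canRL (addrK _)); rewrite subrr.
Qed.

Lemma pr0M a b : pr0 (a * b) = pr0 a * pr0 b.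
Proof.
move: a; apply: (decomposition_ind (agr_dec G)) => [i a ai||a a' Ha Ha'].
- move: b; apply: (decomposition_ind (agr_dec G)) => [j b bj||b b' Hb Hb'].
  + have abij := agrM ai bj.
    case: (posnP i) => [i0|i0]; last first.
      by rewrite (pr0_posg i0 ai) mul0r (pr0_posg _ abij) // addn_gt0 i0.
    case: (posnP j) => [j0|j0]; last first.
      by rewrite (pr0_posg j0 bj) mulr0 (pr0_posg _ abij) // addn_gt0 j0 orbT.
    by move: ai bj abij; rewrite i0 j0 => ai bj abij; rewrite !pr0_id.
  + by rewrite mulr0 linear0 mulr0.
  + by rewrite mulrDr !linearD /= Hb Hb' mulrDr.
- by rewrite mul0r linear0 mul0r.
- by rewrite mulrDl !linearD /= Ha Ha' mulrDl.
Qed.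

Lemma pr01 : pr0 1 = 1.
Proof.
have xe x : x * pr0 1 = x.
  move: x; apply: (decomposition_ind (agr_dec G)) => [n x xn||x y hx hy].
  - have e1 : 1 - pr0 1 \in agr_pos.
      by rewrite -{1}(pr0D 1) addrAC subrr add0r memv_pi.
    have tn : uniq (n :: [seq (n + m)%N | m <- t]).
      rewrite -{1}[n]addn0 -[_ :: _]/([seq (n + m)%N | m <- 0%N :: t]).
      by rewrite map_inj_uniq //; apply: addnI.
    have := decomposition_disjoint (agr_dec G) tn; rewrite big_map => dn.
    have x1 : x * (1 - pr0 1) \in (\sum_(m <- t) agr G (n + m)%N)%VS.
      move: e1; rewrite /agr_pos -/t; move: (1 - _) => y.
      elim: (t) y => [|m s IH] y; first by rewrite !big_nil !memv0 => /eqP->; rewrite mulr0.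
      rewrite !big_cons => /memv_addP[u um [v vs ->]]; rewrite mulrDr.
      by apply: memv_add; [apply: agrM | apply: IH].
    have x2 : x * (1 - pr0 1) \in agr G n.
      rewrite mulrBr mulr1 rpredB //.
      by have := agrM xn (pr0_mem 1); rewrite addn0.
    have: x * (1 - pr0 1) \in (agr G n :&: \sum_(m <- t) agr G (n + m)%N)%VS.
      by rewrite memv_cap x1 x2.
    by rewrite dn memv0 mulrBr mulr1 subr_eq0 => /eqP.
  - by rewrite mul0r.
  - by rewrite mulrDl hx hy.
by rewrite -[LHS]mul1r xe.
Qed.

Fact agr0_is_aspace : is_aspace (agr G 0).
Proof.
apply/andP; split; first by apply: has_algid1; rewrite -pr01 pr0_mem.
by apply/prodvP=> a b a0 b0; apply: (agrM a0 b0).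
Qed.

Definition A0 : {aspace A} := ASpace agr0_is_aspace.

(* The algebra homomorphism A -> A / A_(>0) = A_0. *)
Definition to_A0 (a : A) : subvs_of A0 := vsproj A0 (pr0 a).

Lemma val_to_A0 a : vsval (to_A0 a) = pr0 a.
Proof. by rewrite vsprojK //; apply: pr0_mem. Qed.

Lemma to_A0_linear : linear to_A0.
Proof. by move=> c a b; rewrite /to_A0 !linearP. Qed.

Lemma algid_A0 : algid A0 = 1.
Proof. by apply/eqP; rewrite algid_eq1 -pr01; apply: pr0_mem. Qed.

Lemma to_A01 : to_A0 1 = 1.
Proof. by apply: val_inj; rewrite /= val_to_A0 pr01 algid_A0. Qed.

Lemma to_A0M a b : to_A0 (a * b) = to_A0 a * to_A0 b.
Proof. by apply: val_inj; rewrite /= !val_to_A0 pr0M. Qed.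

End DegreeZero.

Record grmodule (k : fieldType) (A : falgType k) (G : pos_grading A) :=
  GrModule {
    gmod :> module A;
    ggr : int -> {vspace gmod};
    ggr_dec : decomposition ggr;
    ggr_act : forall n i a m, a \in agr G n -> m \in ggr i ->
      mact gmod a m \in ggr (n%:Z + i)
  }.
Arguments ggr {k A G} M i : rename.

Section GradedCategory.
Variables (k : fieldType) (A : falgType k) (G : pos_grading A).
Implicit Types M N P : grmodule G.

Definition is_grmor M N (f : 'Hom(M, N)) : Prop :=
  is_modmor f /\ forall i, (f @: ggr M i <= ggr N i)%VS.

Fact is_grmor_id M : @is_grmor M M \1%VF.
Proof. by split=> [|i]; [apply: is_modmor_id | rewrite lim1g]. Qed.

Fact is_grmor_comp M N P (g : 'Hom(N, P)) (f : 'Hom(M, N)) :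
  is_grmor g -> is_grmor f -> is_grmor (g \o f)%VF.
Proof.
move=> [gP gd] [fP fd]; split=> [|i]; first exact: is_modmor_comp.
by rewrite limg_comp; apply: subv_trans (gd i); apply: limgS.
Qed.

Fact is_grmor_lin M N c (f g : 'Hom(M, N)) :
  is_grmor f -> is_grmor g -> is_grmor (c *: f + g).
Proof.
move=> [fP fd] [gP gd]; split=> [|i]; first exact: is_modmor_lin.
apply/subvP=> _ /memv_imgP[m mi ->]; rewrite add_lfunE scale_lfunE.
by apply: memvD; [apply/memvZ/(subvP (fd i)) | apply/(subvP (gd i))];
  apply: memv_img.
Qed.

Canonical grmodcat : lincat k := LinCat is_grmor_id is_grmor_comp is_grmor_lin.

Section Shift.
Variable r : int.

Definition shift_gr M (i : int) : {vspace M} := ggr M (i - r).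

Fact shift_dec M : decomposition (shift_gr M).
Proof.
case: (ggr_dec M) => dM [s sM]; split=> [u uu|].
  have : uniq [seq i - r | i <- u] by rewrite map_inj_uniq //; apply: addIr.
  by move/dM; rewrite !directvE /= !big_map.
exists [seq i + r | i <- s]; rewrite big_map -sM.
by apply: eq_bigr => i _; rewrite /shift_gr addrK.
Qed.

Fact shift_act M n i a m : a \in agr G n -> m \in shift_gr M i ->
  mact M a m \in shift_gr M (n%:Z + i).
Proof. by rewrite /shift_gr -addrA; apply: ggr_act. Qed.

Definition shift M : grmodule G := GrModule (shift_dec M) (@shift_act M).

Definition shift_mor M N (f : mor M N) : mor (shift M) (shift N) :=
  @Mor k grmodcat (shift M) (shift N) (mfun f)
    (conj (proj1 (morP f)) (fun i => proj2 (morP f) (i - r))).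

Fact shift_mor_id M : shift_mor (idm M) = idm (shift M).
Proof. exact: mor_eq. Qed.

Fact shift_mor_comp M N P (g : mor N P) (f : mor M N) :
  shift_mor (compm g f) = compm (shift_mor g) (shift_mor f).
Proof. exact: mor_eq. Qed.

Definition shift_functor : functor grmodcat grmodcat :=
  @Functor k grmodcat grmodcat shift shift_mor shift_mor_id shift_mor_comp.

End Shift.

Definition concentrated M (i : int) : Prop := ggr M i = fullv.

(* As the radical and the socle of M are graded submodules, these say that the
   head, respectively the socle, of M is concentrated in grade i. *)
Definition head_in M (i : int) : Prop :=
  forall j, j != i -> sub_rad (ggr M j).
Definition socle_in M (i : int) : Prop := soc_sub (ggr M i).

Section DegreeZeroModules.
Variable M : module (subvs_of (A0 G)).

Definition infl_act (a : A) : 'End(M) := mact M (to_A0 G a).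

Fact infl_act_linear : linear infl_act.
Proof. by move=> c a b; rewrite /infl_act to_A0_linear mact_linear. Qed.

Fact infl_act1 : infl_act 1 = \1%VF.
Proof. by rewrite /infl_act to_A01 mact1. Qed.

Fact infl_actM a b : infl_act (a * b) = (infl_act a \o infl_act b)%VF.
Proof. by rewrite /infl_act to_A0M mactM. Qed.

Definition infl_mod : module A := Module infl_act_linear infl_act1 infl_actM.

Definition infl_gr (i : int) : {vspace infl_mod} :=
  if i == 0 then fullv else 0%VS.

Fact infl_dec : decomposition infl_gr.
Proof.
split=> [s us|]; last by exists [:: 0]; rewrite big_seq1.
rewrite directvE /=; have [s0|s0] := boolP (0 \in s).
  have z j : j \in rem 0 s -> infl_gr j = 0%VS.
    by rewrite mem_rem_uniq // inE /infl_gr => /andP[/negPf->].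
  rewrite !(big_rem _ s0) /= !big_seq big1 => [|j /z //].
  by rewrite addv0 big1 ?addn0 // => j /z->; rewrite dimv0.
have z j : j \in s -> infl_gr j = 0%VS.
  by rewrite /infl_gr; case: eqP => // -> js; rewrite js in s0.
by rewrite !big_seq !big1 ?dimv0 // => j /z // ->; rewrite dimv0.
Qed.

Fact infl_gr_act n i a m : a \in agr G n -> m \in infl_gr i ->
  mact infl_mod a m \in infl_gr (n%:Z + i).
Proof.
rewrite /infl_gr => an; case: eqP => [->|_]; last first.
  by rewrite memv0 => /eqP->; rewrite linear0 mem0v.
move=> _; rewrite addr0; case: (posnP n) => [->|n0]; first by rewrite memvf.
by rewrite /= /infl_act /to_A0 (pr0_posg n0 an) linear0 mact0 lfunE mem0v.
Qed.

(* An A_0-module, regarded as a graded A-module concentrated in grade 0. *)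
Definition infl : grmodule G := GrModule infl_dec infl_gr_act.

End DegreeZeroModules.

Section ComponentZero.
Variable M : grmodule G.

Definition comp0_act (a : subvs_of (A0 G)) : 'End(subvs_of (ggr M 0)) :=
  (linfun (vsproj (ggr M 0)) \o mact M (vsval a) \o linfun vsval)%VF.

Let comp0_actE a v : vsval (comp0_act a v) = mact M (vsval a) (vsval v).
Proof.
rewrite /comp0_act !comp_lfunE !lfunE /= vsprojK //.
exact: (@ggr_act _ _ _ M 0%N 0 _ _ (subvsP a) (subvsP v)).
Qed.

Fact comp0_act_linear : linear comp0_act.
Proof.
move=> c a b; apply/lfunP=> v; apply: val_inj.
rewrite add_lfunE scale_lfunE /= !comp0_actE /= mact_linear.
by rewrite add_lfunE scale_lfunE.
Qed.

Fact comp0_act1 : comp0_act 1 = \1%VF.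
Proof.
apply/lfunP=> v; apply: val_inj.
by rewrite /= comp0_actE /= algid_A0 mact1 !id_lfunE.
Qed.

Fact comp0_actM a b : comp0_act (a * b) = (comp0_act a \o comp0_act b)%VF.
Proof.
apply/lfunP=> v; apply: val_inj.
by rewrite comp_lfunE /= !comp0_actE mactM comp_lfunE.
Qed.

(* The grade 0 component of M, as an A_0-module. *)
Definition comp0 : module (subvs_of (A0 G)) :=
  Module comp0_act_linear comp0_act1 comp0_actM.

End ComponentZero.

Definition linear_module M : Prop :=
  exists P : proj_resolution M, forall n, head_in (P n) n%:Z.

Definition colinear_module M : Prop :=
  exists I : inj_resolution M, forall n, socle_in (I n) (- n%:Z).

Definition koszul : Prop :=
  semisimple_algebra (subvs_of (A0 G)) /\
  forall M, irreducible M -> concentrated M 0 -> linear_module M.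

(* A is quasi-hereditary, and D and N are its standard and costandard modules,
   graded with head, respectively socle, in grade 0. *)
Definition graded_qh (d : Order.disp_t) (Lam : finPOrderType d)
    (D N : Lam -> grmodule G) : Prop :=
  (exists L : Lam -> module A,
     [/\ irr_index L, standard_family L D & costandard_family L N]) /\
  forall lam, head_in (D lam) 0 /\ socle_in (N lam) 0.

Definition standard_koszul : Prop :=
  koszul /\
  exists (d : Order.disp_t) (Lam : finPOrderType d) (D N : Lam -> grmodule G),
    graded_qh D N /\
    forall lam, linear_module (D lam) /\ colinear_module (N lam).

Definition q_koszul : Prop :=
  split_algebra A /\
  exists (d : Order.disp_t) (Lam : finPOrderType d)
         (L D N : Lam -> module (subvs_of (A0 G))),
    [/\ irr_index L, standard_family L D, costandard_family L N &
        forall (i : nat) (j : int) lam mu, (0 < i)%N ->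
          ext_neq0 i (infl (D lam)) (shift j (infl (N mu))) -> i%:Z = j].

Definition standard_q_koszul : Prop :=
  split_algebra A /\
  exists (d : Order.disp_t) (Lam : finPOrderType d) (D N : Lam -> grmodule G),
    graded_qh D N /\
    forall (n : nat) (r : int) lam mu,
      (ext_neq0 n (D lam) (shift r (infl (comp0 (N mu)))) -> n%:Z = r) /\
      (ext_neq0 n (infl (comp0 (D mu))) (shift r (N lam)) -> n%:Z = r).

End GradedCategory.

Definition graded_functor (k : fieldType) (A B : falgType k)
    (GB : pos_grading B) (GA : pos_grading A)
    (F : functor (grmodcat GB) (grmodcat GA)) : Prop :=
  additive_functor F /\
  forall r : int, nat_iso (comp_functor F (shift_functor GB r))
                          (comp_functor (shift_functor GA r) F).

(* Main.v *)
From Stdlib Require Import Classical.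
Require Import Defs.
From HB Require Import structures.
From mathcomp Require Import all_boot all_order all_algebra falgebra.

(* Let P be a progenerator of B-mod with End_B(P) = A^op.  Choosing dual bases
   turns P into B^n E for a full idempotent matrix E in M_n(B), and A into
   E M_n(B) E.  As B_(>0) is nilpotent, E is conjugate to its grade 0 part, so
   that P may be generated in grade 0; then A = E M_n(B) E inherits a positive
   grading, and B, A are linked by a Morita context whose structure maps are
   homogeneous of degree 0.  The same matrices (rho : A -> M_n(B),
   tau : B -> M_m(A)) then give mutually inverse functors on modules, on graded
   modules and on modules over the grade 0 parts.  These functors are exact and
   compatible with shifts, inflation from grade 0, grade 0 components, radicals
   and socles, so they carry every property in question from B to A. *)

Set Implicit Arguments.
Unset Strict Implicit.
Unset Printing Implicit Defensive.

Import Order.TTheory GRing.Theory.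
Local Open Scope ring_scope.

(** * Exact equivalences of linear categories *)

(** The given equivalence is an abstract functor between ungraded module categories; it does not
    speak directly of graded modules, of modules over the grade 0 parts, or of scalar extensions
    (needed for splitness). It serves only to extract finitely many elements and maps, and is then
    replaced by functors computed from matrices, whose entrywise formulas make sense in all these
    settings. Moreover exactness, [head_in] and [socle_in] are conditions on underlying spaces,
    which an abstract equivalence does not see; under a matrix functor, kernels, images and grades
    are computed coordinatewise. The grading on [A] is entrywise as well. Since 1 has grade 0, the
    idempotent [rho 1] must have its entries in [B_0], hence the conjugation. The Q-Koszul
    conditions are implications from a nonzero ext, so nonvanishing has to travel from [A] back to
    [B]: [ext_neq0] must be reflected, not only preserved. *)

Section Isomorphisms.
Variables (k : fieldType) (C : lincat k).
Implicit Types X Y Z S : C.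

Lemma compmA X Y Z T (h : mor Z T) (g : mor Y Z) (f : mor X Y) :
  compm h (compm g f) = compm (compm h g) f.
Proof. by apply: mor_eq; apply: comp_lfunA. Qed.

Lemma compm1 X Y (f : mor X Y) : compm f (idm X) = f.
Proof. by apply: mor_eq; apply: comp_lfun1r. Qed.

Lemma comp1m X Y (f : mor X Y) : compm (idm Y) f = f.
Proof. by apply: mor_eq; apply: comp_lfun1l. Qed.

Lemma is_iso_comp X Y Z (g : mor Y Z) (f : mor X Y) :
  is_iso g -> is_iso f -> is_iso (compm g f).
Proof.
move=> [g' [g1 g2]] [f' [f1 f2]]; exists (compm f' g'); split.
  by rewrite -compmA [compm g' _]compmA g1 comp1m.
by rewrite -compmA [compm f _]compmA f2 comp1m.
Qed.

Lemma isomorphic_refl X : isomorphic X X.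
Proof. by exists (idm X), (idm X); rewrite compm1. Qed.

Lemma isomorphic_sym X Y : isomorphic X Y -> isomorphic Y X.
Proof. by move=> [f [g [gf fg]]]; exists g, f. Qed.

Lemma isomorphic_trans X Y Z :
  isomorphic X Y -> isomorphic Y Z -> isomorphic X Z.
Proof.
by move=> [f fP] [g gP]; exists (compm g f); apply: is_iso_comp.
Qed.

Lemma inj_morP X Y (f : mor X Y) : inj_mor f <-> injective (mfun f).
Proof. by split=> [/eqP/lker0P|/lker0P/eqP]. Qed.

Lemma surj_morP X Y (f : mor X Y) :
  surj_mor f <-> forall y, exists x, y = mfun f x.
Proof.
split=> [fs y|fs].
  by have /memv_imgP[x _ ->] : y \in limg f; [rewrite fs memvf | exists x].
by apply/vspaceP=> y; rewrite memvf; have [x ->] := fs y; rewrite memv_img ?memvf.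
Qed.

Lemma exact_atP X Y Z (f : mor X Y) (g : mor Y Z) :
  exact_at f g <->
  (forall x, mfun g (mfun f x) = 0) /\
  (forall y, mfun g y = 0 -> exists x, y = mfun f x).
Proof.
split=> [fg|[gf fg]].
  split=> [x|y /eqP]; first by apply/eqP; rewrite -memv_ker -fg memv_img ?memvf.
  by rewrite -memv_ker -fg => /memv_imgP[x _ ->]; exists x.
apply/vspaceP=> y; rewrite memv_ker; apply/memv_imgP/eqP.
  by case=> x _ ->; apply: gf.
by move=> /fg[x ->]; exists x; rewrite ?memvf.
Qed.

Lemma is_isoP X Y (f : mor X Y) : is_iso f ->
  exists2 g : mor Y X, cancel (mfun f) (mfun g) & cancel (mfun g) (mfun f).
Proof.
move=> [g [gf fg]]; exists g => x.
  by move/(congr1 (fun h => mfun h x)): gf; rewrite /= comp_lfunE id_lfunE.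
by move/(congr1 (fun h => mfun h x)): fg; rewrite /= comp_lfunE id_lfunE.
Qed.

Lemma iso_inj X Y (f : mor X Y) : is_iso f -> inj_mor f.
Proof. by move=> /is_isoP[g gf _]; apply/inj_morP/(can_inj gf). Qed.

Lemma iso_surj X Y (f : mor X Y) : is_iso f -> surj_mor f.
Proof. by move=> /is_isoP[g _ fg]; apply/surj_morP=> y; exists (mfun g y). Qed.

Lemma inj_mor_comp X Y Z (g : mor Y Z) (f : mor X Y) :
  inj_mor g -> inj_mor f -> inj_mor (compm g f).
Proof.
move=> /inj_morP gi /inj_morP fi; apply/inj_morP=> x y /=.
by rewrite !comp_lfunE => /gi/fi.
Qed.

Lemma surj_mor_comp X Y Z (g : mor Y Z) (f : mor X Y) :
  surj_mor g -> surj_mor f -> surj_mor (compm g f).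
Proof.
move=> /surj_morP gs /surj_morP fs; apply/surj_morP=> z.
have [y ->] := gs z; have [x ->] := fs y.
by exists x; rewrite /= comp_lfunE.
Qed.

Lemma subquotient_iso S S' X X' : isomorphic S S' -> isomorphic X X' ->
  subquotient S X -> subquotient S' X'.
Proof.
move=> [s sP] [x xP] [Y [i [p [iP pP]]]]; exists Y, (compm x i), (compm s p).
split; first by apply: inj_mor_comp => //; apply: iso_inj.
by apply: surj_mor_comp => //; apply: iso_surj.
Qed.

Section ResolutionIso.
Variables (X X' : C) (P : proj_resolution X) (f : mor X X') (fP : is_iso f).

Fact proj_resolution_iso_exact : exact_at (pdiff P 0) (compm f (paug P)).
Proof.
have /exact_atP[da ad] := paug_exact P; apply/exact_atP; split=> [x|y] /=.
  by rewrite comp_lfunE da linear0.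
rewrite comp_lfunE => fay; apply: ad.
by apply: (proj1 (inj_morP f) (iso_inj fP)); rewrite fay linear0.
Qed.

Definition proj_resolution_iso : proj_resolution X' :=
  @ProjResolution k C X' (pobj P) (pdiff P) (compm f (paug P)) (@pobj_proj _ _ _ P)
    (surj_mor_comp (iso_surj fP) (paug_surj P)) proj_resolution_iso_exact
    (pdiff_exact P).

End ResolutionIso.

(** In the first argument only the augmentation of the resolution changes, so cocycles stay
    cocycles. In the second, cocycles are composed with [f], and coboundaries are brought back by
    its inverse [g]. *)
Lemma ext_neq0_iso n X X' Y Y' : isomorphic X X' -> isomorphic Y Y' ->
  ext_neq0 n X Y -> ext_neq0 n X' Y'.
Proof.
move=> [h hP] [f [g [gf fg]]] [P [z [zc zb]]].
have gfz T (w : mor T Y) : compm g (compm f w) = w by rewrite compmA gf comp1m.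
exists (proj_resolution_iso P hP), (compm f z : mor (P n) Y'); split.
  by rewrite /cocycle /= -comp_lfunA zc comp_lfun0r.
move=> b; apply: zb; case: n z b {zc} => [|m] z /= b.
  by rewrite -(gfz _ z) /= b comp_lfun0r.
by have [u uP] := b; exists (compm g u); rewrite -compmA -uP gfz.
Qed.

(** Replaces maps from or to a zero object, which a [lincat] need not contain: injectivity of [f] is
    exactness at [zero_end X], [f], and surjectivity is exactness at [f], [zero_end Y]. *)
Definition zero_end X : mor X X := linm (-1) (idm X) (idm X).

Lemma zero_endE X : mfun (zero_end X) = 0.
Proof. by rewrite /= scaleN1r addNr. Qed.

End Isomorphisms.

Section ExactFunctors.
Variable k : fieldType.
Implicit Types C D : lincat k.

Definition exact_functor C D (F : functor C D) : Prop :=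
  linear_functor F /\
  forall X Y Z (f : mor X Y) (g : mor Y Z),
    exact_at f g -> exact_at (fmor F f) (fmor F g).

Section ExactFunctor.
Variables (C D : lincat k) (F : functor C D) (Flin : linear_functor F).

Lemma fmor_zero X Y (f : mor X Y) : mfun f = 0 -> mfun (fmor F f) = 0.
Proof.
(* Zero is written as a linear combination of morphisms, the only form in which a linear functor
   recognises it. *)
move=> f0; have -> : f = linm (-1) f f.
  by apply: mor_eq; rewrite /= scaleN1r addNr.
by rewrite Flin /= scaleN1r addNr.
Qed.

Lemma fobj_zero X : fullv = 0%VS :> {vspace car X} ->
  fullv = 0%VS :> {vspace car (F X)}.
Proof.
move=> X0; have id0 : mfun (idm X) = 0.
  apply/lfunP=> x; rewrite zero_lfunE; apply/eqP.
  by rewrite -memv0 -X0 memvf.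
apply/vspaceP=> x; rewrite memvf memv0; apply/esym/eqP.
have := fmor_zero id0; rewrite fmor_id /= => /lfunP/(_ x).
by rewrite id_lfunE zero_lfunE.
Qed.

Lemma is_iso_fmor X Y (f : mor X Y) : is_iso f -> is_iso (fmor F f).
Proof.
by move=> [g [gf fg]]; exists (fmor F g); rewrite -!fmor_comp gf fg !fmor_id.
Qed.

Lemma isomorphic_fobj X Y : isomorphic X Y -> isomorphic (F X) (F Y).
Proof. by move=> [f /is_iso_fmor]; exists (fmor F f). Qed.

Hypothesis Fex : forall X Y Z (f : mor X Y) (g : mor Y Z),
    exact_at f g -> exact_at (fmor F f) (fmor F g).

Lemma inj_fmor X Y (f : mor X Y) : inj_mor f -> inj_mor (fmor F f).
Proof.
move=> fi; have : exact_at (zero_end X) f by rewrite /exact_at zero_endE lim0g fi.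
by move/Fex; rewrite /exact_at (fmor_zero (zero_endE X)) lim0g => E; apply/esym.
Qed.

Lemma surj_fmor X Y (f : mor X Y) : surj_mor f -> surj_mor (fmor F f).
Proof.
move=> fs; have : exact_at f (zero_end Y).
  rewrite /exact_at zero_endE fs; apply/vspaceP=> y.
  by rewrite memvf memv_ker zero_lfunE eqxx.
move/Fex; rewrite /exact_at (fmor_zero (zero_endE Y)) => E; rewrite /surj_mor E.
by apply/vspaceP=> y; rewrite memvf memv_ker zero_lfunE eqxx.
Qed.

Lemma short_exact_fmor X Y Z (f : mor X Y) (g : mor Y Z) :
  short_exact f g -> short_exact (fmor F f) (fmor F g).
Proof.
by move=> [fi fg gs]; split; [exact: inj_fmor|exact: Fex|exact: surj_fmor].
Qed.

Lemma subquotient_fobj S X : subquotient S X -> subquotient (F S) (F X).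
Proof.
move=> [Y [i [p [iI pS]]]]; exists (F Y), (fmor F i), (fmor F p).
by split; [apply: inj_fmor | apply: surj_fmor].
Qed.

Lemma filtered_by_fobj (S : C -> Prop) (S' : D -> Prop) X :
  (forall Z, S Z -> S' (F Z)) -> filtered_by S X -> filtered_by S' (F X).
Proof.
move=> SS'; elim=> {X} [X X0|X Y Z f g fg _ IH /SS' SZ].
  by apply: filtered_zero; apply: fobj_zero.
exact: filtered_ext (short_exact_fmor fg) IH SZ.
Qed.

End ExactFunctor.

(** In an arbitrary [lincat], injectivity and exactness belong to the underlying spaces and not to
    the category, so an equivalence need not respect them; exactness is imposed on both functors. *)
Definition exact_equivalence C D (F : functor C D) (G : functor D C) : Prop :=
  [/\ exact_functor F, exact_functor G,
      nat_iso (comp_functor G F) (id_functor C) &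
      nat_iso (comp_functor F G) (id_functor D)].

Lemma exact_equivalence_sym C D (F : functor C D) (G : functor D C) :
  exact_equivalence F G -> exact_equivalence G F.
Proof. by case. Qed.

Lemma nat_iso_faithful C D (F : functor C D) (G : functor D C) X Y
    (f g : mor X Y) :
  nat_iso (comp_functor G F) (id_functor C) -> fmor F f = fmor F g -> f = g.
Proof.
move=> [eta [etaI etaN]] fg.
have := etaN _ _ f; rewrite /= fg -[LHS]/(compm _ (fmor (comp_functor G F) g)).
rewrite etaN /=; have [h [_ eh]] := etaI X.
by move/(congr1 (fun u => compm u h)); rewrite -!compmA eh !compm1.
Qed.

(** The preimage is [fmor G h] conjugated by the isomorphisms [eta]. That [F] sends it to [h] is
    checked after applying [G], which is faithful by the second natural isomorphism. *)
Lemma nat_iso_full C D (F : functor C D) (G : functor D C) X Y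
    (h : mor (F X) (F Y)) :
  nat_iso (comp_functor G F) (id_functor C) ->
  nat_iso (comp_functor F G) (id_functor D) -> exists f : mor X Y, fmor F f = h.
Proof.
move=> [eta [etaI etaN]] ni; have [e [ee e1]] := etaI X; have [e' [ee' _]] := etaI Y.
exists (compm (eta Y) (compm (fmor G h) e)).
apply: (nat_iso_faithful ni); have := etaN _ _ (compm (eta Y) (compm (fmor G h) e)).
move/(congr1 (compm e')); rewrite /= !compmA ee' !comp1m => ->.
by rewrite -!compmA ee compm1.
Qed.

Section Equivalence.
Variables (C D : lincat k) (F : functor C D) (G : functor D C).
Hypothesis FG : exact_equivalence F G.

Lemma equivalence_faithful X Y (f g : mor X Y) : fmor F f = fmor F g -> f = g.
Proof. by case: FG => _ _ ni _; apply: nat_iso_faithful ni. Qed.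

Lemma equivalence_full X Y (h : mor (F X) (F Y)) :
  exists f : mor X Y, fmor F f = h.
Proof. by case: FG => _ _ ni ni'; apply: nat_iso_full ni ni'. Qed.

Lemma equivalence_unit X : isomorphic (G (F X)) X.
Proof. by case: FG => _ _ [eta [etaI _]] _; exists (eta X); exact: etaI. Qed.

Lemma equivalence_counit Y : isomorphic (F (G Y)) Y.
Proof. by case: FG => _ _ _ [eta [etaI _]]; exists (eta Y); exact: etaI. Qed.

Lemma equivalence_isomorphic X Y : isomorphic (F X) (F Y) -> isomorphic X Y.
Proof.
move=> /(isomorphic_fobj G) GXY.
apply: isomorphic_trans (equivalence_unit Y).
exact: isomorphic_trans (isomorphic_sym (equivalence_unit X)) GXY.
Qed.

End Equivalence.

Section Transport.
Variables (C D : lincat k) (F : functor C D) (G : functor D C).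
Hypothesis FG : exact_equivalence F G.
Let GF := exact_equivalence_sym FG.
Let Flin : linear_functor F. Proof. by case: FG => [[]]. Qed.
Let Fex X Y Z (f : mor X Y) (g : mor Y Z) :
  exact_at f g -> exact_at (fmor F f) (fmor F g).
Proof. by case: FG => [[_ H] _ _ _]; apply: H. Qed.
Let Glin : linear_functor G. Proof. by case: FG => [_ []]. Qed.
Let Gex X Y Z (f : mor X Y) (g : mor Y Z) :
  exact_at f g -> exact_at (fmor G f) (fmor G g).
Proof. by case: FG => [_ [_ H] _ _]; apply: H. Qed.

(** [G] moves the lifting problem to [C], where [G (F P)] is isomorphic to [P]; the lift returns
    because [G] is full and faithful. Exactness of [G] keeps [e] surjective. *)
Lemma projective_fobj P : projective P -> projective (F P).
Proof.
move=> Pp X Y e f es; have [u [v [vu uv]]] := equivalence_unit FG P.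
have [h hP] := Pp _ _ (fmor G e) (compm (fmor G f) v) (surj_fmor Glin Gex es).
have [h' h'P] := equivalence_full GF (compm h u).
exists h'; apply: (equivalence_faithful GF).
by rewrite fmor_comp h'P compmA -hP -compmA vu compm1.
Qed.

Lemma injective_fobj I : injective_obj I -> injective_obj (F I).
Proof.
move=> Ii X Y e f ei; have [u [v [vu uv]]] := equivalence_unit FG I.
have [h hP] := Ii _ _ (fmor G e) (compm u (fmor G f)) (inj_fmor Glin Gex ei).
have [h' h'P] := equivalence_full GF (compm v h).
exists h'; apply: (equivalence_faithful GF).
by rewrite fmor_comp h'P -compmA -hP compmA vu comp1m.
Qed.

Definition proj_resolution_fobj X (P : proj_resolution X) :
    proj_resolution (F X) :=
  @ProjResolution k D (F X) (fun n => F (P n)) (fun n => fmor F (pdiff P n))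
    (fmor F (paug P)) (fun n => projective_fobj (@pobj_proj _ _ _ P n))
    (surj_fmor Flin Fex (paug_surj P)) (Fex (paug_exact P))
    (fun n => Fex (pdiff_exact P n)).

Definition inj_resolution_fobj X (I : inj_resolution X) :
    inj_resolution (F X) :=
  @InjResolution k D (F X) (fun n => F (I n)) (fun n => fmor F (idiff I n))
    (fmor F (icoaug I)) (fun n => injective_fobj (@iobj_inj _ _ _ I n))
    (inj_fmor Flin Fex (icoaug_inj I)) (Fex (icoaug_exact I))
    (fun n => Fex (idiff_exact I n)).

Lemma ext_neq0_fobj n X Y : ext_neq0 n X Y -> ext_neq0 n (F X) (F Y).
Proof.
move=> [P [z [zc zb]]]; exists (proj_resolution_fobj P), (fmor F z); split.
  have zc' : mfun (compm z (pdiff P n)) = 0 by exact: zc.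
  by have := fmor_zero Flin zc'; rewrite fmor_comp.
move=> b; apply: zb; case: n z b {zc} => [|m] z /= b.
  suff -> : z = linm (-1) z z by rewrite /= scaleN1r addNr.
  apply: (equivalence_faithful FG); rewrite Flin; apply: mor_eq.
  by rewrite /= b scaler0 add0r.
have [h hP] := b; have [h' h'P] := equivalence_full FG h; exists h'.
by apply: (equivalence_faithful FG); rewrite hP fmor_comp h'P.
Qed.

End Transport.

Section Reflection.
Variables (C D : lincat k) (F : functor C D) (G : functor D C).
Hypothesis FG : exact_equivalence F G.

Lemma ext_neq0_equivalence n X Y : ext_neq0 n (F X) (F Y) -> ext_neq0 n X Y.
Proof.
move=> /(ext_neq0_fobj (exact_equivalence_sym FG)).
by apply: ext_neq0_iso; apply: equivalence_unit FG _.
Qed.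

Lemma subquotient_equivalence S X : subquotient (F S) (F X) -> subquotient S X.
Proof.
have [_ [Glin Gex] _ _] := FG => /(subquotient_fobj Glin Gex).
by apply: subquotient_iso; apply: equivalence_unit FG _.
Qed.

End Reflection.

End ExactFunctors.

(** * Submodules, quotients, radicals and socles *)

Section LinearLfun.
Variables (k : fieldType) (U V : vectType k) (f : U -> V) (fl : linear f).

Let f' : {linear U -> V} := HB.pack f (GRing.isLinear.Build k U V *:%R f fl).

Definition lin_lfun : 'Hom(U, V) := linfun f'.

Lemma lin_lfunE x : lin_lfun x = f x.
Proof. exact: lfunE. Qed.

End LinearLfun.

(** [Q] is an undecidable predicate, so a spanning list is grown by classical case analysis: either
    the list already spans, or an element outside its span is added. [d] bounds the missing
    dimension. *)
Lemma exists_spanning (k : fieldType) (V : vectType k) (Q : V -> Prop) :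
  exists s : seq V, (forall x, x \in s -> Q x) /\ forall x, Q x -> x \in <<s>>%VS.
Proof.
suff H d : forall s : seq V, (forall x, x \in s -> Q x) ->
    (\dim {:V} <= \dim <<s>> + d)%N ->
    exists s' : seq V, (forall x, x \in s' -> Q x) /\
      forall x, Q x -> x \in <<s'>>%VS.
  by apply: (H (\dim {:V}) [::]) => //; apply: leq_addl.
elim: d => [|d IH] s sQ sd.
  exists s; split=> // x _; have /eqP-> : <<s>>%VS == fullv; last exact: memvf.
  by rewrite eqEdim subvf -[X in (_ <= X)%N]addn0.
have [[x [Qx xs]]|sat] := classic (exists x, Q x /\ x \notin <<s>>%VS); last first.
  exists s; split=> // x Qx; apply: contraT => xs; exfalso; apply: sat.
  by exists x.
apply: (IH (x :: s)) => [y|]; first by rewrite inE => /orP[/eqP->|/sQ].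
have x0 : x != 0 by apply: contraNneq xs => ->; apply: mem0v.
apply: leq_trans sd _; rewrite addnS -addSn leq_add2r span_cons.
rewrite dimv_disjoint_sum ?dim_vline ?x0 //.
apply/eqP; rewrite -subv0; apply/subvP=> y; rewrite memv_cap => /andP[].
case/vlineP=> c ->; have [->|c0] := eqVneq c 0; first by rewrite scale0r !mem0v.
by move/(memvZ c^-1); rewrite scalerA mulVf // scale1r (negPf xs).
Qed.

Lemma lfun_vsprojE (k : fieldType) (V : vectType k) (U : {vspace V}) (v : V) :
  v \in U -> vsval (linfun (vsproj U) v) = v.
Proof. by move=> vU; rewrite lfunE /= vsprojK. Qed.

Lemma lfun_vsvalE (k : fieldType) (V : vectType k) (U : {vspace V})
  (x : subvs_of U) : linfun vsval x = vsval x.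
Proof. exact: lfunE. Qed.

Section RetractModule.
Variables (k : fieldType) (A : falgType k) (V : vectType k) (e : 'End(V)).
Variable act : A -> 'End(V).
Hypothesis act_linear : linear act.
Hypothesis act1 : forall v, v \in limg e -> e (act 1 v) = v.
Hypothesis actM : forall a b v, v \in limg e ->
  e (act (a * b) v) = e (act a (e (act b v))).

(** Neither is [e] required to be [A]-linear nor [act] to be a unital action. One construction thus
    serves submodules ([e] a projection onto [U]), quotients ([e] the complementary projection) and
    the modules [mxmod] below. *)
Definition retract_act (a : A) : 'End(subvs_of (limg e)) :=
  (linfun (vsproj (limg e)) \o (e \o act a) \o linfun vsval)%VF.

Fact val_retract_act a x : vsval (retract_act a x) = e (act a (vsval x)).
Proof.
rewrite /retract_act !comp_lfunE lfun_vsprojE; last by rewrite memv_img ?memvf.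
by rewrite [linfun _ x]lfunE.
Qed.

Fact retract_act_linear : linear retract_act.
Proof.
move=> c a b; apply/lfunP=> x; apply: subvs_inj.
rewrite add_lfunE scale_lfunE /= !val_retract_act act_linear.
by rewrite add_lfunE scale_lfunE linearP.
Qed.

Fact retract_act1 : retract_act 1 = \1%VF.
Proof.
apply/lfunP=> x; apply: subvs_inj.
by rewrite /= val_retract_act act1 ?id_lfunE ?subvsP.
Qed.

Fact retract_actM a b :
  retract_act (a * b) = (retract_act a \o retract_act b)%VF.
Proof.
apply/lfunP=> x; apply: subvs_inj.
by rewrite comp_lfunE /= !val_retract_act actM ?subvsP.
Qed.

Definition retract_module : module A :=
  Module retract_act_linear retract_act1 retract_actM.

Lemma val_retract a (x : retract_module) :
  vsval (mact retract_module a x) = e (act a (vsval x)).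
Proof. exact: val_retract_act. Qed.

End RetractModule.

Section Submodules.
Variables (k : fieldType) (A : falgType k).
Implicit Types M N S : module A.

Lemma submodule_obj M (U : {vspace M}) : submodule U ->
  exists (X : module A) (i : mor X M), inj_mor i /\ limg i = U.
Proof.
move=> Us; have pid v : v \in limg (projv U) -> v \in U by rewrite limg_proj.
have a1 v : v \in limg (projv U) -> projv U (mact M 1 v) = v.
  by move=> /pid vU; rewrite mact1 id_lfunE projv_id.
have aM a b v : v \in limg (projv U) ->
    projv U (mact M (a * b) v) = projv U (mact M a (projv U (mact M b v))).
  move=> /pid vU; rewrite mactM comp_lfunE [projv U (mact M b v)]projv_id //.
  exact: Us.
pose X := retract_module (@mact_linear _ _ M) a1 aM.
have iP : is_modmor (linfun vsval : 'Hom(X, M)).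
  move=> a x; rewrite !lfun_vsvalE val_retract projv_id //.
  exact/Us/pid/subvsP.
exists X, (@Mor _ (modcat A) X M _ iP); split.
  by apply/inj_morP=> x y; rewrite /= !lfun_vsvalE => /val_inj.
apply/vspaceP=> v; apply/memv_imgP/idP => /= [[x _ ->]|vU].
  by rewrite lfun_vsvalE; apply/pid/subvsP.
exists (vsproj (limg (projv U)) v); rewrite ?memvf // lfun_vsvalE vsprojK //.
by rewrite limg_proj.
Qed.

(** The quotient lives on a linear complement of [U]. The complementary projection [q] depends only
    on the class modulo [U], and [U] is stable, whence [q a q = q a] for the action of each [a]. *)
Lemma quotient_obj M (U : {vspace M}) : submodule U ->
  exists (X : module A) (p : mor M X), surj_mor p /\ lker p = U.
Proof.
move=> Us; pose q := (\1 - projv U)%VF : 'End(M).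
have qE v : q v = v - projv U v by rewrite add_lfunE opp_lfunE id_lfunE.
have q0 v : v \in U -> q v = 0 by move=> vU; rewrite qE projv_id ?subrr.
have vq v : v - q v \in U by rewrite qE opprB addrCA subrr addr0 memv_proj.
have qeq v w : v - w \in U -> q v = q w.
  by move=> /q0/eqP; rewrite linearB subr_eq0 => /eqP.
have qq v : q (q v) = q v.
  exact/esym/qeq/vq.
have qi v : v \in limg q -> q v = v by move=> /memv_imgP[w _ ->].
have qa a v : q (mact M a (q v)) = q (mact M a v).
  by apply/esym/qeq; rewrite -linearB; apply/Us/vq.
have a1 v : v \in limg q -> q (mact M 1 v) = v.
  by move=> /qi vq'; rewrite mact1 id_lfunE.
have aM a b v : v \in limg q ->
    q (mact M (a * b) v) = q (mact M a (q (mact M b v))).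
  by move=> _; rewrite qa mactM comp_lfunE.
pose X := retract_module (@mact_linear _ _ M) a1 aM.
have pE (v : M) : vsval ((linfun (vsproj (limg q)) \o q)%VF v) = q v.
  by rewrite comp_lfunE lfun_vsprojE ?memv_img ?memvf.
have pP : is_modmor ((linfun (vsproj (limg q)) \o q)%VF : 'Hom(M, X)).
  by move=> a v; apply: subvs_inj; rewrite pE val_retract pE qa.
exists X, (@Mor _ (modcat A) M X _ pP); split.
  apply/surj_morP=> x; exists (vsval x); apply: subvs_inj.
  by rewrite /= pE qi ?subvsP.
apply/vspaceP=> v; rewrite memv_ker; apply/eqP/idP => /= [|vU].
  by move/(congr1 vsval); rewrite pE => qv; have := vq v; rewrite qv subr0.
by apply: subvs_inj; rewrite pE q0.
Qed.

Lemma submodule_limg M N (f : mor M N) (U : {vspace M}) :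
  submodule U -> submodule (f @: U)%VS.
Proof.
by move=> Us a _ /memv_imgP[m mU ->]; rewrite -(morP f) memv_img ?Us.
Qed.

Lemma submodule_full M : submodule (fullv : {vspace M}).
Proof. by move=> a m _; rewrite memvf. Qed.

Lemma submodule_preim M N (f : mor M N) (U : {vspace N}) :
  submodule U -> submodule (f @^-1: U)%VS.
Proof.
by move=> Us a m; rewrite -!memv_preim (morP f) => /Us.
Qed.

Lemma submodule_lker M N (f : mor M N) : submodule (lker f).
Proof.
by move=> a m; rewrite !memv_ker (morP f) => /eqP->; rewrite linear0.
Qed.

End Submodules.

Arguments submodule_limg {k A M N} f {U} Us.
Arguments submodule_preim {k A M N} f {U} Us.
Arguments submodule_lker {k A M N} f.
Arguments submodule_full {k A} M.

Section Irreducible.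
Variables (k : fieldType) (A : falgType k).
Implicit Types M S : module A.

(** A functor acts on morphisms and not on subspaces; this form of irreducibility can be
    transported. *)
Lemma irreducibleP S : irreducible S <->
  fullv <> 0%VS :> {vspace S} /\
  forall (X : module A) (i : mor X S), mfun i = 0 \/ surj_mor i.
Proof.
split=> -[S0 Sm]; split=> //; first last.
  move=> U Us; have [X [i [iI <-]]] := submodule_obj Us.
  by case: (Sm X i) => [->|->]; [left; rewrite lim0g | right].
move=> X i.
have [i0|] := Sm _ (submodule_limg i (submodule_full X)); last by right.
left; apply/lfunP=> x; apply/eqP.
by rewrite zero_lfunE -memv0 -i0 memv_img ?memvf.
Qed.

(* By Schur, a nonzero map to an irreducible module is onto, with maximal
   kernel; dually for a nonzero map from an irreducible module. *)
Lemma sub_radP M (W : {vspace M}) : sub_rad W <->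
  forall (S : module A) (p : mor M S), irreducible S -> (W <= lker p)%VS.
Proof.
split=> [Wr S p [S0 Sm]|Wr U [Us Uf Um]].
  have [p0|ps] := Sm _ (submodule_limg p (submodule_full M)).
    by rewrite lkerE -subv0 -p0 limgS ?subvf.
  apply: Wr; split=> [|pf|V Vs pV]; first exact: submodule_lker.
    by apply: S0; rewrite -ps; apply/eqP; rewrite -lkerE pf.
  have [V0|Vf] := Sm _ (submodule_limg p Vs).
    by left; apply/eqP; rewrite eqEsubv pV andbT lkerE V0.
  right; apply/vspaceP=> x; rewrite memvf.
  have /memv_imgP[v vV xv] : mfun p x \in (mfun p @: V)%VS by rewrite Vf memvf.
  rewrite -[x](subrK v) memvD // (subvP pV) // memv_ker linearB /= xv subrr.
  exact: eqxx.
have [S [p [ps pU]]] := quotient_obj Us; rewrite -pU; apply: Wr; split=> [S0|V Vs].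
  apply: Uf; rewrite -pU; apply/vspaceP=> x.
  by rewrite memvf memv_ker -memv0 -S0 memvf.
have UV : (U <= mfun p @^-1: V)%VS.
  by rewrite -pU; apply/subvP=> x; rewrite memv_ker -memv_preim => /eqP->; apply: mem0v.
have VE : V = (mfun p @: (mfun p @^-1: V))%VS.
  by rewrite lpreimK // ps subvf.
have [E|E] := Um _ (submodule_preim p Vs) UV.
  by left; rewrite VE E -pU; apply/eqP; rewrite -lkerE.
by right; rewrite VE E.
Qed.

Lemma simple_submodule_limg S M (i : mor S M) :
  irreducible S -> inj_mor i -> simple_submodule (limg i).
Proof.
move=> [S0 Sm] iI; have i0 : lker i == 0%VS by apply/eqP.
split=> [|E|W Ws Wi]; first exact/submodule_limg/submodule_full.
  by apply: S0; apply/eqP; rewrite -subv0 -(limg_ker0 _ _ i0) E sub0v.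
have -> : W = (mfun i @: (mfun i @^-1: W))%VS by rewrite lpreimK.
by case: (Sm _ (submodule_preim i Ws)) => ->; [left; rewrite limg0 | right].
Qed.

Lemma simple_submodule_obj M (U : {vspace M}) : simple_submodule U ->
  exists (S : module A) (i : mor S M), [/\ irreducible S, inj_mor i & limg i = U].
Proof.
move=> [Us U0 Um]; have [S [i [iI iU]]] := submodule_obj Us.
exists S, i; split=> //; have i0 : lker i == 0%VS by apply/eqP.
split=> [S0|W Ws]; first by apply: U0; rewrite -iU S0 limg0.
have Wi : (mfun i @: W <= U)%VS by rewrite -iU limgS ?subvf.
have [E|E] := Um _ (submodule_limg i Ws) Wi; [left|right]; apply/eqP.
  by rewrite -subv0 -(limg_ker0 _ _ i0) E sub0v.
by rewrite eqEsubv subvf -(limg_ker0 _ _ i0) iU E subvv.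
Qed.

Lemma soc_subP M (W : {vspace M}) : soc_sub W <->
  forall (S : module A) (i : mor S M),
    irreducible S -> inj_mor i -> (limg i <= W)%VS.
Proof.
split=> Ws => [S i Si ii|U /simple_submodule_obj[S [i [Si ii <-]]]]; last exact: Ws.
exact/Ws/simple_submodule_limg.
Qed.

End Irreducible.

Section IrreducibleEquivalence.
Variables (k : fieldType) (A B : falgType k).
Variables (F : functor (modcat A) (modcat B)) (G : functor (modcat B) (modcat A)).

Lemma irreducible_iso (S S' : module A) :
  isomorphic S S' -> irreducible S -> irreducible S'.
Proof.
move=> [f fP] /irreducibleP[S0 Sm]; have [g [gf fg]] := fP.
have gP : is_iso g by exists f.
apply/irreducibleP; split=> [S'0|X i].
  apply: S0; apply/vspaceP=> x; rewrite memvf memv0; apply/esym/eqP.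
  apply: (proj1 (inj_morP f) (iso_inj fP)); rewrite linear0; apply/eqP.
  by rewrite -memv0 -S'0 memvf.
have iE : i = compm f (compm g i) by rewrite compmA fg comp1m.
rewrite iE; case: (Sm X (compm g i)) => [E|gis].
  by left; rewrite [LHS]/= -[(g \o i)%VF]/(mfun (compm g i)) E comp_lfun0r.
by right; apply: surj_mor_comp => //; apply: iso_surj.
Qed.

(** A map [i] into [F S] equals [fmor F (fmor G i)] up to isomorphism. The inner map goes into
    [G (F S)], which is isomorphic to [S] and hence irreducible, so it is zero or onto, and [F]
    preserves both cases. *)
Lemma irreducible_fobj (S : module A) :
  exact_equivalence F G -> irreducible S -> irreducible (F S).
Proof.
move=> FG Si; have GFi := irreducible_iso (isomorphic_sym (equivalence_unit FG S)) Si.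
have [[Flin Fex] [Glin _] _ [eta [etaI etaN]]] := FG.
have /irreducibleP[GF0 GFm] := GFi; apply/irreducibleP; split=> [F0|X i].
  by apply: GF0; apply: (fobj_zero Glin F0).
have [e [ee' e'e]] := etaI X.
have iE : i = compm (eta (F S)) (compm (fmor F (fmor G i)) e).
  have := etaN _ _ i; rewrite /= => E.
  by rewrite compmA E -compmA e'e compm1.
case: (GFm _ (fmor G i)) => [G0|Gs]; [left|right].
  have F0 := fmor_zero Flin G0.
  by rewrite iE /= F0 comp_lfun0l comp_lfun0r.
rewrite iE; apply: surj_mor_comp; first exact/iso_surj/etaI.
apply: surj_mor_comp; first exact: (surj_fmor Flin Fex Gs).
by apply: iso_surj; exists (eta X).
Qed.

End IrreducibleEquivalence.

(** * The regular module and its orbit maps *)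

Section RegularModule.
Variables (k : fieldType) (A : falgType k).

Section Orbit.
Variables (M : module A) (x : M).

Fact orbit_linear : linear (fun a : A => mact M a x).
Proof. by move=> c a b; rewrite mact_linear add_lfunE scale_lfunE. Qed.

Fact is_modmor_orbit : @is_modmor k A (regular A) M (lin_lfun orbit_linear).
Proof.
move=> a b; rewrite !(lin_lfunE orbit_linear) -comp_lfunE -mactM.
by congr (mact M _ x); apply: lfunE.
Qed.

Definition orbit_mor : @mor k (modcat A) (regular A) M :=
  @Mor k (modcat A) (regular A) M _ is_modmor_orbit.

Lemma orbit_morE a : orbit_mor a = mact M a x.
Proof. exact: lin_lfunE. Qed.

End Orbit.

Lemma regular_actE (a b : A) : mact (regular A) a b = a * b.
Proof. exact: lfunE. Qed.

Lemma mor_regularE (M : module A) (f : @mor k (modcat A) (regular A) M) (a : A) :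
  f a = mact M a (f 1).
Proof. by rewrite -(morP f) regular_actE mulr1. Qed.

Lemma orbit_mor1 (M : module A) (f : @mor k (modcat A) (regular A) M) :
  f = orbit_mor (f 1).
Proof. by apply: mor_eq; apply/lfunP=> a; rewrite orbit_morE mor_regularE. Qed.

Lemma orbit_mor_linear (M : module A) c (x y : M) :
  orbit_mor (c *: x + y) = linm c (orbit_mor x) (orbit_mor y).
Proof.
apply: mor_eq; apply/lfunP=> a; rewrite orbit_morE linearP /=.
by rewrite add_lfunE scale_lfunE -!orbit_morE.
Qed.

Lemma orbit_mor_id : orbit_mor (1 : regular A) = idm (regular A).
Proof.
by apply: mor_eq; apply/lfunP=> a; rewrite orbit_morE regular_actE mulr1 id_lfunE.
Qed.

Lemma orbit_mor_comp (M N : module A) (f : mor M N) (x : M) :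
  compm f (orbit_mor x) = orbit_mor (f x).
Proof.
by apply: mor_eq; apply/lfunP=> b; rewrite comp_lfunE !orbit_morE (morP f).
Qed.

(** The span of [Q] is a left ideal. The quotient map by it kills [Q], hence is zero, so the ideal
    contains 1. The coefficients are absorbed into the [x i] because [Q] is stable under left
    multiplication. *)
Lemma sum_eq1 (Q : A -> Prop) :
    (forall a b, Q b -> Q (a * b)) ->
    (forall (C : module A) (p : @mor k (modcat A) (regular A) C),
       (forall a, Q a -> p a = 0) -> mfun p = 0) ->
  exists (n : nat) (x : 'I_n -> A), (forall i, Q (x i)) /\ \sum_i x i = 1.
Proof.
move=> Qm Qq; have [s [sQ Qs]] := exists_spanning Q.
have sub : @submodule k A (regular A) <<s>>%VS.
  move=> a m ms; rewrite regular_actE (coord_span (X := in_tuple s) ms) mulr_sumr.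
  apply: memv_suml => i _; rewrite -scalerAr; apply/memvZ/Qs/Qm/sQ.
  by rewrite mem_nth.
have [C [p [ps pU]]] := quotient_obj sub.
have p0 : mfun p = 0.
  by apply: Qq => a /Qs; rewrite -pU memv_ker => /eqP.
have s1 : 1 \in <<s>>%VS by rewrite -pU p0 memv_ker zero_lfunE.
exists (size s), (fun i => coord (in_tuple s) i 1 *: s`_i); split=> [i|].
  rewrite -[s`_i]mul1r scalerAl; apply: Qm; apply: sQ.
  by rewrite mem_nth.
by rewrite [RHS](coord_span (X := in_tuple s) s1).
Qed.

End RegularModule.

(** * Decompositions and gradings *)

Section Projections.
Variables (k : fieldType) (V : vectType k) (I : choiceType).
Implicit Types (W : I -> {vspace V}) (pi : I -> 'End(V)) (s : seq I).

(** Directness defined by dimension counts is awkward to transport through matrices, whereas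
    projections can be applied entry by entry. The gradings on [mxmod] and on the corner are both
    obtained in this way. *)
Definition projections W pi s : Prop :=
  [/\ forall i x, pi i x \in W i,
      forall i x, x \in W i -> pi i x = x,
      forall i j x, x \in W j -> j != i -> pi i x = 0 &
      forall x, x = \sum_(i <- s) pi i x].

Lemma decomposition_projections W : decomposition W ->
  exists pi s, projections W pi s.
Proof.
move=> dW; have [s0 s0V] := proj2 dW; pose s := undup s0.
have sV : (\sum_(i <- s) W i = fullv)%VS.
  apply/eqP; rewrite eqEsubv subvf -s0V [X in (X <= _)%VS]big_seq; apply/subvP.
  elim/big_rec: _ => [x|i U is0 IH x]; first by rewrite memv0 => /eqP->; apply: mem0v.
  move=> /memv_addP[u uW [v vs ->]]; apply: memvD; last exact: IH.
  have si : i \in s by rewrite mem_undup.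
  by rewrite (big_rem _ si) /=; apply: (subvP (addvSl _ _)).
have us : uniq s := undup_uniq s0.
have W0 i : i \notin s -> W i = 0%VS.
  move=> si; have ui : uniq (i :: s) by rewrite /= si.
  by have := decomposition_disjoint dW ui; rewrite sV capvf.
(* For [i] outside [s], [rem i s] is [s] and [W i] is zero, so [W i] and [R i] are complementary in
   every case. *)
pose R i := (\sum_(j <- rem i s) W j)%VS.
have RW i : (W i :&: R i = 0)%VS.
  by apply: (decomposition_disjoint dW); rewrite /= mem_rem_uniqF // rem_uniq.
have RWf i : (W i + R i = fullv)%VS.
  have [si|si] := boolP (i \in s); first by rewrite -sV (big_rem _ si).
  by rewrite W0 // add0v /R rem_id.
have Wid i x : x \in W i -> daddv_pi (W i) (R i) x = x by apply: daddv_pi_id.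
have Worth i j x : x \in W j -> j != i -> daddv_pi (W i) (R i) x = 0.
  move=> xj ji; have xR : x \in R i.
    have [sj|sj] := boolP (j \in s); last first.
      by move: xj; rewrite W0 // memv0 => /eqP->; apply: mem0v.
    have rj : j \in rem i s by rewrite mem_rem_uniq // inE ji.
    by rewrite /R (big_rem _ rj) /=; apply: (subvP (addvSl _ _)).
  have RW' : (R i :&: W i = 0)%VS by rewrite capvC.
  have := daddv_pi_add (RW i) (w := x); rewrite RWf memvf => /(_ isT).
  by rewrite (daddv_pi_id RW' xR) => /(canRL (addrK _)); rewrite subrr.
exists (fun i => daddv_pi (W i) (R i)), s; split=> //.
  by move=> i x; apply: memv_pi.
apply: (decomposition_ind dW) => [j x xj||x y xE yE]; last first.
- by rewrite {1}xE {1}yE -big_split; apply: eq_bigr => i _; rewrite linearD.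
- by rewrite big1 // => i _; rewrite linear0.
have [sj|sj] := boolP (j \in s); last first.
  by move: xj; rewrite W0 // memv0 => /eqP->; rewrite big1 // => i _; rewrite linear0.
rewrite (bigD1_seq j) //= Wid // big1 ?addr0 // => i ij.
by apply: Worth xj _; rewrite eq_sym.
Qed.

Lemma projections_decomposition W pi s : projections W pi s -> decomposition W.
Proof.
case=> piW piid piorth pisum; split=> [t|]; last first.
  exists s; apply/vspaceP=> x; rewrite memvf (pisum x).
  by elim/big_rec2: _ => [|i U y _ IH]; rewrite ?mem0v // memv_add.
rewrite directvE /=; elim: t => [|i t IH] /=; first by rewrite !big_nil dimv0.
move=> /andP[it ut]; rewrite !big_cons dimv_disjoint_sum.
  by rewrite (eqP (IH ut)).
apply/eqP; rewrite -subv0; apply/subvP=> x; rewrite memv_cap memv0 => /andP[xi xt].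
rewrite -(piid _ _ xi); apply/eqP; move: x {xi} xt; elim: t it {IH ut} => [|j t IH].
  by move=> _ x; rewrite big_nil memv0 => /eqP->; rewrite linear0.
rewrite inE negb_or => /andP[ij it] x; rewrite big_cons => /memv_addP[u uj [v vt ->]].
by rewrite linearD /= (piorth _ _ _ uj) 1?eq_sym // IH ?addr0.
Qed.

End Projections.

(** * The functor of a matrix representation *)

(* Not unital in general: the matrix of 1 is only an idempotent. *)
Record mxrep (k : fieldType) (A B : falgType k) := MxRep {
  mxdim : nat;
  mxent :> 'I_mxdim -> 'I_mxdim -> 'Hom(A, B);
  mxentM : forall a b i j,
    mxent i j (a * b) = \sum_l mxent i l a * mxent l j b
}.

Section MatrixFunctor.
Variables (k : fieldType) (A B : falgType k) (r : mxrep A B).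
Local Notation n := (mxdim r).
Implicit Types M N : module B.

Section Object.
Variable M : module B.
Local Notation V := {ffun 'I_n -> M}.

Definition ffun_act (a : A) (v : V) : V :=
  [ffun i => \sum_j mact M (r i j a) (v j)].

Fact ffun_act_linearr a : linear (ffun_act a).
Proof.
move=> c u v; apply/ffunP=> i; rewrite !ffunE scaler_sumr -big_split.
by apply: eq_bigr => j _; rewrite !ffunE linearP.
Qed.

Definition ffun_lact a : 'End(V) := lin_lfun (ffun_act_linearr a).

Lemma ffun_lactE a v i : ffun_lact a v i = \sum_j mact M (r i j a) (v j).
Proof. by rewrite lin_lfunE ffunE. Qed.

Fact ffun_lact_linear : linear ffun_lact.
Proof.
move=> c a b; apply/lfunP=> v; apply/ffunP=> i.
rewrite add_lfunE scale_lfunE !ffunE !ffun_lactE scaler_sumr -big_split.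
by apply: eq_bigr => j _; rewrite linearP mact_linear add_lfunE scale_lfunE.
Qed.

Fact mact_sum (I : finType) (b : I -> B) (x : M) :
  mact M (\sum_i b i) x = \sum_i mact M (b i) x.
Proof.
apply: (big_morph (fun b => mact M b x)) => [a c|]; last by rewrite mact0 zero_lfunE.
by rewrite -[a]scale1r mact_linear !scale1r add_lfunE.
Qed.

Lemma ffun_lactM a b v : ffun_lact (a * b) v = ffun_lact a (ffun_lact b v).
Proof.
apply/ffunP=> i; rewrite !ffun_lactE.
under eq_bigr => j _ do rewrite mxentM mact_sum.
rewrite exchange_big; apply: eq_bigr => l _; rewrite ffun_lactE linear_sum.
by apply: eq_bigr => j _; rewrite mactM comp_lfunE.
Qed.

Lemma ffun_lact_limg v : v \in limg (ffun_lact 1) -> ffun_lact 1 v = v.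
Proof. by move=> /memv_imgP[w _ ->]; rewrite -ffun_lactM mulr1. Qed.

Fact mxmod_act1 v : v \in limg (ffun_lact 1) -> ffun_lact 1 (ffun_lact 1 v) = v.
Proof. by move=> /ffun_lact_limg vE; rewrite !vE. Qed.

Fact mxmod_actM a b v : v \in limg (ffun_lact 1) ->
  ffun_lact 1 (ffun_lact (a * b) v) =
  ffun_lact 1 (ffun_lact a (ffun_lact 1 (ffun_lact b v))).
Proof. by rewrite -!ffun_lactM !mul1r mulr1. Qed.

(* The module e M^n, where e is the matrix of 1: a model of Hom_B(B^n e, M). *)
Definition mxmod : module A :=
  retract_module ffun_lact_linear mxmod_act1 mxmod_actM.

Fact mxcoord_linear i : linear (fun x : mxmod => (vsval x : V) i).
Proof. by move=> c x y; rewrite linearP !ffunE. Qed.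

Definition mxcoord i : 'Hom(mxmod, M) := lin_lfun (mxcoord_linear i).

(** An arbitrary tuple is forced into the module by the matrix of 1. A tuple already fixed by that
    idempotent is unchanged, which is how [mxcoord_act1] enters the computations below. *)
Definition mxmk (v : 'I_n -> M) : mxmod :=
  vsproj (limg (ffun_lact 1)) (ffun_lact 1 (finfun v)).

Lemma mxcoord_mk v i : mxcoord i (mxmk v) = \sum_j mact M (r i j 1) (v j).
Proof.
rewrite lin_lfunE /mxmk vsprojK ?memv_img ?memvf // ffun_lactE.
by apply: eq_bigr => j _; rewrite ffunE.
Qed.

Lemma mxcoord_inj x y : (forall i, mxcoord i x = mxcoord i y) -> x = y.
Proof.
move=> xy; apply: subvs_inj; apply/ffunP=> i.
by have := xy i; rewrite !lin_lfunE.
Qed.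

Lemma mxcoord_act a x i :
  mxcoord i (mact mxmod a x) = \sum_j mact M (r i j a) (mxcoord j x).
Proof.
rewrite lin_lfunE val_retract -ffun_lactM mul1r ffun_lactE.
by apply: eq_bigr => j _; rewrite lin_lfunE.
Qed.

Lemma mxcoord_act1 x i : \sum_j mact M (r i j 1) (mxcoord j x) = mxcoord i x.
Proof. by rewrite -mxcoord_act mact1 id_lfunE. Qed.

(** [U] is any subspace, not only a submodule: kernels and images of [mxmor], and later the grades,
    all have this form. *)
Definition mxsub (U : {vspace M}) : {vspace mxmod} :=
  (\bigcap_i (mxcoord i @^-1: U))%VS.

Lemma mem_mxsub (U : {vspace M}) x :
  reflect (forall i, mxcoord i x \in U) (x \in mxsub U).
Proof.
rewrite memvE; apply: (iffP subv_bigcapP) => xU i; last first.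
  by move=> _; rewrite -memvE -memv_preim.
by rewrite memv_preim memvE xU.
Qed.

End Object.

Section Morphism.
Variables (M N : module B) (f : 'Hom(M, N)).

Fact mxlfun_linear :
  linear (fun x : mxmod M => mxmk (fun i => f (mxcoord M i x))).
Proof.
move=> c x y; apply: mxcoord_inj => i.
rewrite [RHS]linearP /= !mxcoord_mk scaler_sumr -big_split.
by apply: eq_bigr => j _; rewrite !linearP.
Qed.

Definition mxlfun : 'Hom(mxmod M, mxmod N) := lin_lfun mxlfun_linear.

Lemma mxlfunE x : mxlfun x = mxmk (fun i => f (mxcoord M i x)).
Proof. exact: lin_lfunE. Qed.

Hypothesis fP : is_modmor f.

Lemma mxcoord_lfun x i : mxcoord N i (mxlfun x) = f (mxcoord M i x).
Proof.
rewrite mxlfunE mxcoord_mk -[in RHS]mxcoord_act1 linear_sum.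
by apply: eq_bigr => j _; rewrite /= fP.
Qed.

Lemma is_modmor_mxlfun : is_modmor mxlfun.
Proof.
move=> a x; apply: mxcoord_inj => i.
rewrite mxcoord_lfun !mxcoord_act linear_sum.
by apply: eq_bigr => j _; rewrite mxcoord_lfun /= fP.
Qed.

End Morphism.

Definition mxmor M N (f : mor M N) : mor (mxmod M) (mxmod N) :=
  @Mor _ (modcat A) (mxmod M) (mxmod N) _ (is_modmor_mxlfun (morP f)).

Lemma mxcoord_mor M N (f : mor M N) x i :
  mxcoord N i (mxmor f x) = f (mxcoord M i x).
Proof. exact: (mxcoord_lfun (morP f)). Qed.

Fact mxmor_id M : mxmor (idm M) = idm (mxmod M).
Proof.
apply: mor_eq; apply/lfunP=> x; apply: mxcoord_inj => i.
by rewrite mxcoord_mor !id_lfunE.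
Qed.

Fact mxmor_comp M N P (g : mor N P) (f : mor M N) :
  mxmor (compm g f) = compm (mxmor g) (mxmor f).
Proof.
apply: mor_eq; apply/lfunP=> x; apply: mxcoord_inj => i.
by rewrite comp_lfunE !mxcoord_mor comp_lfunE.
Qed.

Definition mxfunctor : functor (modcat B) (modcat A) :=
  @Functor k (modcat B) (modcat A) mxmod mxmor mxmor_id mxmor_comp.

Lemma mxfunctor_linear : linear_functor mxfunctor.
Proof.
move=> M N c f g; apply: mor_eq; apply/lfunP=> x; apply: mxcoord_inj => i.
rewrite [LHS]mxcoord_mor /= !add_lfunE !scale_lfunE linearP /=.
by rewrite !(mxcoord_lfun (morP _)).
Qed.

Lemma lker_mxmor M N (f : mor M N) : lker (mxmor f) = mxsub (lker f).
Proof.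
apply/vspaceP=> x; rewrite memv_ker; apply/eqP/mem_mxsub => [fx0 i|fx0].
  by rewrite memv_ker -mxcoord_mor fx0 linear0.
apply: mxcoord_inj => i; rewrite mxcoord_mor linear0; apply/eqP.
by rewrite -memv_ker.
Qed.

Lemma limg_mxmor M N (f : mor M N) : limg (mxmor f) = mxsub (limg f).
Proof.
apply/vspaceP=> y; apply/memv_imgP/mem_mxsub => [[x _ ->] i|yf].
  by rewrite mxcoord_mor memv_img ?memvf.
(* Preimages are picked coordinatewise with the linear pseudo-inverse of [f], ignoring the
   idempotent. [mxmk] repairs this: [f] commutes with the action, and the coordinates of [y] are
   fixed by the idempotent. *)
exists (mxmk (fun i => f^-1%VF (mxcoord N i y))); rewrite ?memvf //.
apply: mxcoord_inj => i; rewrite mxcoord_mor mxcoord_mk linear_sum.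
rewrite -[LHS]mxcoord_act1; apply: eq_bigr => j _.
by rewrite /= (morP f) limg_lfunVK.
Qed.

Lemma mxfunctor_exact : exact_functor mxfunctor.
Proof.
split; first exact: mxfunctor_linear.
by move=> M N P f g fg; rewrite /exact_at limg_mxmor lker_mxmor fg.
Qed.

Lemma mxsub_full M : mxsub (fullv : {vspace M}) = fullv.
Proof. by apply/vspaceP=> x; rewrite memvf; apply/mem_mxsub => i; apply: memvf. Qed.

End MatrixFunctor.

(** * Matrix functors on graded modules *)

Definition ungraded (k : fieldType) (A : falgType k) (G : pos_grading A)
    (M N : grmodule G) (f : mor M N) : @mor k (modcat A) M N :=
  @Mor k (modcat A) M N (mfun f) (proj1 (morP f)).

Section GradedMatrixFunctor.
Variables (k : fieldType) (A B : falgType k).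
Variables (GA : pos_grading A) (GB : pos_grading B) (r : mxrep A B).
Implicit Types M N : grmodule GB.

Definition mxgraded : Prop :=
  forall i j d a, a \in agr GA d -> r i j a \in agr GB d.
Hypothesis rG : mxgraded.

Lemma agr_one (C : falgType k) (GC : pos_grading C) : 1 \in agr GC 0.
Proof. by rewrite -(pr01 GC) pr0_mem. Qed.

Lemma act0_gr M i b x : b \in agr GB 0 -> x \in ggr M i -> mact M b x \in ggr M i.
Proof. by move=> b0 xi; have := ggr_act b0 xi; rewrite add0r. Qed.

Lemma projections_act0 M pi s i b x :
  projections (ggr M) pi s -> b \in agr GB 0 ->
  pi i (mact M b x) = mact M b (pi i x).
Proof.
move=> [pm pid po _] b0; move: x; apply: (decomposition_ind (ggr_dec M)).
- move=> j x xj; have [->|ji] := eqVneq i j; first by rewrite !pid ?act0_gr.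
  have ij : j != i by rewrite eq_sym.
  by rewrite (po i j x) // (po i j (mact M b x)) ?act0_gr // linear0.
- by rewrite !linear0.
- by move=> x y xE yE; rewrite !linearD /= xE yE.
Qed.

Section GradedObject.
Variable M : grmodule GB.

Definition mxgr (i : int) : {vspace mxmod r M} := mxsub r (ggr M i).

(** The entries [r i j 1] have grade 0, so they commute with the projections of [M] onto its grades.
    Applied to all coordinates, these projections therefore preserve the tuples fixed by the matrix
    of 1. *)
Fact mxgr_dec : decomposition mxgr.
Proof.
have [pi [s P]] := decomposition_projections (ggr_dec M).
have [pm pid po psum] := P.
have qlin i : linear (fun x : mxmod r M => mxmk (fun j => pi i (mxcoord M j x))).
  move=> c x y; apply: mxcoord_inj => j.
  rewrite [RHS]linearP /= !mxcoord_mk scaler_sumr -big_split.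
  by apply: eq_bigr => l _; rewrite !linearP.
have qE i x j : mxcoord M j (lin_lfun (qlin i) x) = pi i (mxcoord M j x).
  rewrite [lin_lfun _ x]lin_lfunE mxcoord_mk -[in RHS]mxcoord_act1 linear_sum.
  apply: eq_bigr => l _; rewrite /= (projections_act0 _ _ P) //.
  exact/rG/agr_one.
apply: (@projections_decomposition _ _ _ _ (fun i => lin_lfun (qlin i)) s).
split=> [i x|i x /mem_mxsub xi|i j x /mem_mxsub xj ji|x].
- by apply/mem_mxsub => j; rewrite qE.
- by apply: mxcoord_inj => j; rewrite qE pid.
- by apply: mxcoord_inj => l; rewrite qE (po i j) // linear0.
apply: mxcoord_inj => j; rewrite linear_sum [LHS]psum.
by apply: eq_bigr => i _; rewrite /= qE.
Qed.

Fact mxgr_act d i a x : a \in agr GA d -> x \in mxgr i ->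
  mact (mxmod r M) a x \in mxgr (d%:Z + i).
Proof.
move=> ad /mem_mxsub xi; apply/mem_mxsub => j; rewrite mxcoord_act.
by apply: memv_suml => l _; apply: ggr_act => //; apply: rG.
Qed.

Definition mxgrmod : grmodule GA := GrModule mxgr_dec mxgr_act.

End GradedObject.

Fact is_grmor_mxmor M N (f : mor M N) :
  @is_grmor k A GA (mxgrmod M) (mxgrmod N) (mxmor r (ungraded f)).
Proof.
split; first exact: morP.
move=> i; apply/subvP=> _ /memv_imgP[x /mem_mxsub xi ->].
apply/mem_mxsub => j; rewrite mxcoord_mor.
by apply: (subvP (proj2 (morP f) i)); apply: memv_img.
Qed.

Definition mxgrmor M N (f : mor M N) : mor (mxgrmod M) (mxgrmod N) :=
  @Mor k (grmodcat GA) (mxgrmod M) (mxgrmod N) _ (is_grmor_mxmor f).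

Fact mxgrmor_id M : mxgrmor (idm M) = idm (mxgrmod M).
Proof.
apply: mor_eq; rewrite -[LHS]/(mfun (mxmor r (ungraded (idm M)))).
have -> : ungraded (idm M) = @idm k (modcat B) M by apply: mor_eq.
by rewrite mxmor_id.
Qed.

Fact mxgrmor_comp M N P (g : mor N P) (f : mor M N) :
  mxgrmor (compm g f) = compm (mxgrmor g) (mxgrmor f).
Proof.
apply: mor_eq; rewrite -[LHS]/(mfun (mxmor r (ungraded (compm g f)))).
have -> : ungraded (compm g f) = compm (ungraded g) (ungraded f) by apply: mor_eq.
by rewrite mxmor_comp.
Qed.

Definition mxgrfunctor : functor (grmodcat GB) (grmodcat GA) :=
  @Functor k (grmodcat GB) (grmodcat GA) mxgrmod mxgrmor mxgrmor_id mxgrmor_comp.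

Lemma mxgrfunctor_exact : exact_functor mxgrfunctor.
Proof.
split=> [M N c f g|M N P f g fg].
  apply: mor_eq; rewrite -[LHS]/(mfun (fmor (mxfunctor r) (ungraded (linm c f g)))).
  have -> : ungraded (linm c f g) = linm c (ungraded f) (ungraded g).
    exact: mor_eq.
  by rewrite mxfunctor_linear.
rewrite /exact_at /= -[LHS]/(limg (mxmor r (ungraded f))).
rewrite -[RHS]/(lker (mxmor r (ungraded g))).
by rewrite limg_mxmor lker_mxmor fg.
Qed.

End GradedMatrixFunctor.

(** * Morita contexts in matrix form *)

Section Context.
Variables (k : fieldType) (A B : falgType k) (r : mxrep A B) (t : mxrep B A).
Variables (X : 'I_(mxdim r) -> 'I_(mxdim t) -> B).
Variables (Y : 'I_(mxdim t) -> 'I_(mxdim r) -> B).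

(* A Morita context of bimodules P, Q with pairings <p, q> in B, [q, p] in A and
   1 = sum_i [q_i, p_i], 1 = sum_l <p'_l, q'_l> yields r i j a = <p_i a, q_j>,
   t l h b = [q'_l b, p'_h], X i l = <p_i, q'_l> and Y l i = <p'_l, q_i>. *)
Definition mxcontext : Prop :=
  (forall b l h i j, r i j (t l h b) = X i l * b * Y h j) /\
  \sum_l \sum_i Y l i * X i l = 1.
Hypothesis ctx : mxcontext.

Let rt b l h i j : r i j (t l h b) = X i l * b * Y h j. Proof. exact: ctx.1. Qed.
Let YX1 : \sum_l \sum_i Y l i * X i l = 1. Proof. exact: ctx.2. Qed.

Section ContextObject.
Variable M : module B.
Local Notation FM := (mxmod t (mxmod r M)).

Fact mxcounit_linear : linear (fun v : FM =>
  \sum_l \sum_i mact M (Y l i) (mxcoord M i (mxcoord (mxmod r M) l v))).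
Proof.
move=> c u v; rewrite scaler_sumr -big_split; apply: eq_bigr => l _.
rewrite scaler_sumr -big_split; apply: eq_bigr => i _.
by rewrite !linearP.
Qed.

Definition mxcounit_lfun : 'Hom(FM, M) := lin_lfun mxcounit_linear.

Lemma mxcounitE v : mxcounit_lfun v =
  \sum_l \sum_i mact M (Y l i) (mxcoord M i (mxcoord (mxmod r M) l v)).
Proof. exact: lin_lfunE. Qed.

(** The factorisation of [r i j (t l h b)] collapses the double sum to the counit. For [b = 1] it
    shows that [v] is determined by its counit; together with the second half of [mxcontext] it
    makes the counit [B]-linear. *)
Lemma mxcoord2_act b v i l :
  mxcoord M i (mxcoord (mxmod r M) l (mact FM b v)) =
  mact M (X i l) (mact M b (mxcounit_lfun v)).
Proof.
rewrite mxcounitE mxcoord_act !linear_sum; apply: eq_bigr => h _.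
rewrite /= mxcoord_act !linear_sum; apply: eq_bigr => j _.
by rewrite /= rt !mactM !comp_lfunE.
Qed.

Lemma mxcoord2 v i l :
  mxcoord M i (mxcoord (mxmod r M) l v) = mact M (X i l) (mxcounit_lfun v).
Proof. by have := mxcoord2_act 1 v i l; rewrite !mact1 !id_lfunE. Qed.

Lemma mact_context x : \sum_l \sum_i mact M (Y l i) (mact M (X i l) x) = x.
Proof.
rewrite -[RHS](id_lfunE x) -(mact1 M) -YX1 mact_sum; apply: eq_bigr => l _.
by rewrite mact_sum; apply: eq_bigr => i _; rewrite mactM comp_lfunE.
Qed.

Fact is_modmor_mxcounit : is_modmor mxcounit_lfun.
Proof.
move=> b v; rewrite mxcounitE -[RHS]mact_context; apply: eq_bigr => l _.
by apply: eq_bigr => i _; rewrite mxcoord2_act.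
Qed.

Lemma mxcounit_inj : injective mxcounit_lfun.
Proof.
move=> u v uv; apply: mxcoord_inj => l; apply: mxcoord_inj => i.
by rewrite !mxcoord2 uv.
Qed.

(** Each tuple [X i l], with [l] fixed, is invariant under the matrix of 1. This follows by writing
    [X] through entries [r (t 1)], which that matrix fixes by multiplicativity. Thus [mxmk] does not
    alter the coordinates in [mxunit]. *)
Lemma context_r1X i l : \sum_j r i j 1 * X j l = X i l.
Proof.
have XE j : X j l = \sum_h \sum_p r j p (t l h 1) * X p h.
  rewrite -[LHS]mulr1 -{1}YX1 mulr_sumr; apply: eq_bigr => h _.
  by rewrite mulr_sumr; apply: eq_bigr => p _; rewrite rt mulr1 mulrA.
under eq_bigr => j _ do rewrite XE mulr_sumr.
rewrite exchange_big XE; apply: eq_bigr => h _ /=.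
under eq_bigr => j _ do rewrite mulr_sumr.
rewrite exchange_big; apply: eq_bigr => p _ /=.
rewrite -[t l h 1]mul1r mxentM mulr_suml; apply: eq_bigr => j _.
by rewrite mul1r mulrA.
Qed.

Definition mxunit (x : M) : FM :=
  mxmk (fun l => mxmk (fun i => mact M (X i l) x)).

Lemma mxcoord2_unit x i l :
  mxcoord M i (mxcoord (mxmod r M) l (mxunit x)) = mact M (X i l) x.
Proof.
rewrite mxcoord_mk -[in RHS](mact_context x) !linear_sum; apply: eq_bigr => h _.
rewrite /= mxcoord_act !linear_sum; apply: eq_bigr => j _.
rewrite mxcoord_mk rt mulr1 mactM comp_lfunE /=; congr (mact _ _ (mact _ _ _)).
rewrite -[in RHS]context_r1X mact_sum; apply: eq_bigr => p _.
by rewrite mactM comp_lfunE.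
Qed.

Lemma mxunitK : cancel mxunit mxcounit_lfun.
Proof.
move=> x; rewrite mxcounitE -[RHS]mact_context; apply: eq_bigr => l _.
by apply: eq_bigr => i _; rewrite mxcoord2_unit.
Qed.

Lemma mxcounitK : cancel mxcounit_lfun mxunit.
Proof. by move=> v; apply: mxcounit_inj; rewrite mxunitK. Qed.

Fact mxunit_linear : linear mxunit.
Proof.
by move=> c x y; apply: mxcounit_inj; rewrite linearP /= !mxunitK.
Qed.

Definition mxunit_lfun : 'Hom(M, FM) := lin_lfun mxunit_linear.

Lemma mxunit_lfunE x : mxunit_lfun x = mxunit x.
Proof. exact: lin_lfunE. Qed.

Fact is_modmor_mxunit : is_modmor mxunit_lfun.
Proof.
move=> b x; rewrite !mxunit_lfunE; apply: mxcounit_inj.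
by rewrite is_modmor_mxcounit !mxunitK.
Qed.

End ContextObject.

Lemma mxcounit_natural M N (f : mor M N) v :
  mxcounit_lfun N (mxmor t (mxmor r f) v) = f (mxcounit_lfun M v).
Proof.
rewrite !mxcounitE linear_sum; apply: eq_bigr => l _.
rewrite linear_sum; apply: eq_bigr => i _.
by rewrite !mxcoord_mor /= (morP f).
Qed.

(** Half of an equivalence; the other half is the same statement for a context with [r] and [t]
    exchanged. *)
Lemma mxcounit_nat_iso :
  nat_iso (comp_functor (mxfunctor t) (mxfunctor r)) (id_functor (modcat B)).
Proof.
exists (fun M => @Mor k (modcat B) (mxmod t (mxmod r M)) M _ (@is_modmor_mxcounit M)).
split=> [M|M N f].
  exists (@Mor k (modcat B) M (mxmod t (mxmod r M)) _ (@is_modmor_mxunit M)).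
  split; apply: mor_eq; apply/lfunP=> x; rewrite comp_lfunE /= mxunit_lfunE.
    by rewrite mxcounitK id_lfunE.
  by rewrite mxunitK id_lfunE.
by apply: mor_eq; apply/lfunP=> v; rewrite !comp_lfunE /= mxcounit_natural.
Qed.

Section GradedContext.
Variables (GA : pos_grading A) (GB : pos_grading B).
Hypotheses (rG : mxgraded GA GB r) (tG : mxgraded GB GA t).
Hypotheses (X0 : forall i l, X i l \in agr GB 0).
Hypotheses (Y0 : forall l i, Y l i \in agr GB 0).

Lemma mxcounit_nat_iso_graded :
  nat_iso (comp_functor (mxgrfunctor tG) (mxgrfunctor rG)) (id_functor (grmodcat GB)).
Proof.
have cP (M : grmodule GB) : @is_grmor _ _ GB (mxgrmod tG (mxgrmod rG M)) M (mxcounit_lfun M).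
  split; first exact: is_modmor_mxcounit.
  move=> i; apply/subvP=> _ /memv_imgP[v /mem_mxsub vi ->]; rewrite mxcounitE.
  apply: memv_suml => l _; apply: memv_suml => j _; apply: act0_gr => //.
  by have /mem_mxsub := vi l; apply.
have uP (M : grmodule GB) :
    @is_grmor _ _ GB M (mxgrmod tG (mxgrmod rG M)) (mxunit_lfun M).
  split; first exact: is_modmor_mxunit.
  move=> i; apply/subvP=> _ /memv_imgP[v vi ->]; rewrite mxunit_lfunE.
  apply/mem_mxsub => l; apply/mem_mxsub => j; rewrite mxcoord2_unit.
  exact: act0_gr.
exists (fun M => @Mor k (grmodcat GB) (mxgrmod tG (mxgrmod rG M)) M _ (cP M)).
split=> [M|M N f].
  exists (@Mor k (grmodcat GB) M (mxgrmod tG (mxgrmod rG M)) _ (uP M)).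
  split; apply: mor_eq; apply/lfunP=> x; rewrite comp_lfunE /= mxunit_lfunE.
    by rewrite mxcounitK id_lfunE.
  by rewrite mxunitK id_lfunE.
apply: mor_eq; apply/lfunP=> v; rewrite !comp_lfunE.
by have := mxcounit_natural (ungraded f) v; rewrite /= => <-.
Qed.

End GradedContext.

End Context.
Arguments mxcontext {k A B} r t X Y.

(** * Transfer of module-theoretic properties *)

Section Transfer.
Variables (k : fieldType) (A B : falgType k) (r : mxrep A B) (t : mxrep B A).
Local Notation F := (mxfunctor r).
Local Notation G := (mxfunctor t).
Hypothesis FG : exact_equivalence F G.

Let GF : exact_equivalence G F := exact_equivalence_sym FG.
Let Flin : linear_functor F. Proof. exact: mxfunctor_linear. Qed.
Let Fex X Y Z (f : mor X Y) (g : mor Y Z) :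
  exact_at f g -> exact_at (fmor F f) (fmor F g).
Proof. exact: (mxfunctor_exact r).2. Qed.

(** By [sub_radP], [W] is tested against maps to irreducible modules. Up to the counit, such a map
    out of [F M] is [fmor F p'] with [p'] from [M] to the irreducible [G S]; it acts coordinatewise,
    and [p'] kills [W]. *)
Lemma sub_rad_mx (M : module B) (W : {vspace M}) :
  sub_rad W -> sub_rad (mxsub r W).
Proof.
move=> /sub_radP Wr; apply/sub_radP => S p Si.
have [e eI] := equivalence_counit FG S; have [e' [e'e ee']] := eI.
have [p' p'P] := equivalence_full FG (compm e' p).
have pE : p = compm e (fmor F p') by rewrite p'P compmA ee' comp1m.
have Wp' : (W <= lker p')%VS by apply/Wr/(irreducible_fobj GF Si).
apply/subvP=> x /mem_mxsub xW; rewrite memv_ker pE /= comp_lfunE.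
suff -> : fmor F p' x = 0 by rewrite linear0.
apply: mxcoord_inj => i; rewrite mxcoord_mor linear0; apply/eqP.
by rewrite -memv_ker (subvP Wp').
Qed.

Lemma soc_sub_mx (M : module B) (W : {vspace M}) :
  soc_sub W -> soc_sub (mxsub r W).
Proof.
move=> /soc_subP Ws; apply/soc_subP => S i Si iI.
have [e eI] := equivalence_counit FG S; have [e' [e'e ee']] := eI.
have [i' i'P] := equivalence_full FG (compm i e).
have iE : i = compm (fmor F i') e' by rewrite i'P -compmA ee' compm1.
have Si' : irreducible (G S) by apply: (irreducible_fobj GF Si).
(* Injectivity is known for [fmor F i'], hence for its image under [G]; conjugation by the unit
   brings it back to [i']. *)
have i'I : inj_mor i'.
  have Gi : inj_mor (fmor G (fmor F i')).
    apply: (inj_fmor (mxfunctor_linear t) (mxfunctor_exact t).2).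
    by rewrite i'P; apply: inj_mor_comp => //; apply: iso_inj.
  have [_ _ [eta [etaI etaN]] _] := FG.
  have [h hP] := etaI (G S).
  have -> : i' = compm (eta M) (compm (fmor G (fmor F i')) h).
    have := etaN _ _ i'; rewrite compmA => -> /=.
    by rewrite -compmA hP.2 compm1.
  apply: inj_mor_comp; first exact/iso_inj/etaI.
  by apply: inj_mor_comp => //; apply: iso_inj; exists (eta (G S)); case: hP.
have iW : (limg i' <= W)%VS by apply: Ws.
apply/subvP=> _ /memv_imgP[x _ ->]; rewrite iE /= comp_lfunE.
apply/mem_mxsub => j; rewrite (mxcoord_lfun (morP i')) (subvP iW) //.
by rewrite memv_img ?memvf.
Qed.

Lemma is_head_mx (M S : module B) (p : mor M S) :
  is_head p -> is_head (fmor F p).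
Proof.
move=> [ps pr]; split; first exact: (surj_fmor Flin Fex ps).
by rewrite lker_mxmor; apply: sub_rad_mx.
Qed.

Lemma is_socle_mx (M S : module B) (i : mor S M) :
  is_socle i -> is_socle (fmor F i).
Proof.
move=> [iI ir]; split; first exact: (inj_fmor Flin Fex iI).
by rewrite limg_mxmor; apply: soc_sub_mx.
Qed.

Lemma irr_index_mx (Lam : Type) (L : Lam -> module B) :
  irr_index L -> irr_index (fun lam => F (L lam)).
Proof.
move=> [Li Linj Lall]; split=> [lam|lam mu|S Si].
- exact: (irreducible_fobj FG (Li lam)).
- by move=> /(equivalence_isomorphic FG)/Linj.
have [lam lamP] := Lall _ (irreducible_fobj GF Si); exists lam.
apply: isomorphic_trans (isomorphic_fobj F lamP).
exact/isomorphic_sym/equivalence_counit.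
Qed.

Section Weights.
Variables (d : Order.disp_t) (Lam : finPOrderType d) (L : Lam -> module B).

(** Only the order condition uses that subquotients are reflected; the other clauses are preserved
    by an exact equivalence. *)
Lemma standard_family_mx (D : Lam -> module B) : standard_family L D ->
  standard_family (fun lam => F (L lam)) (fun lam => F (D lam)).
Proof.
move=> H lam; have [[R [i [p [ip hp Rm]]]] [P [K [h [j [q [Pp hh jq fK]]]]]]] := H lam.
split.
  exists (F R), (fmor F i), (fmor F p); split.
  - exact: (short_exact_fmor Flin Fex ip).
  - exact: is_head_mx.
  - by move=> mu /(subquotient_equivalence FG)/Rm.
exists (F P), (F K), (fmor F h), (fmor F j), (fmor F q); split.
- exact: (projective_fobj FG Pp).
- exact: is_head_mx.
- exact: (short_exact_fmor Flin Fex jq).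
apply: (filtered_by_fobj Flin Fex) fK => Z [nu lnu Znu]; exists nu => //.
exact: isomorphic_fobj.
Qed.

Lemma costandard_family_mx (N : Lam -> module B) : costandard_family L N ->
  costandard_family (fun lam => F (L lam)) (fun lam => F (N lam)).
Proof.
move=> H lam; have [[Q [i [p [ip hp Rm]]]] [I [K [h [j [q [Pp hh jq fK]]]]]]] := H lam.
split.
  exists (F Q), (fmor F i), (fmor F p); split.
  - exact: (short_exact_fmor Flin Fex ip).
  - exact: is_socle_mx.
  - by move=> mu /(subquotient_equivalence FG)/Rm.
exists (F I), (F K), (fmor F h), (fmor F j), (fmor F q); split.
- exact: (injective_fobj FG Pp).
- exact: is_socle_mx.
- exact: (short_exact_fmor Flin Fex jq).
apply: (filtered_by_fobj Flin Fex) fK => Z [nu lnu Znu]; exists nu => //.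
exact: isomorphic_fobj.
Qed.

End Weights.

Lemma quasi_hereditary_mx : quasi_hereditary B -> quasi_hereditary A.
Proof.
move=> [d [Lam [L [D [Lirr Dstd]]]]].
exists d, Lam, (fun lam => F (L lam)), (fun lam => F (D lam)); split.
  exact: irr_index_mx.
exact: standard_family_mx.
Qed.

End Transfer.

(** * Absolute irreducibility and splitness *)

Section AbsolutelyIrreducible.
Import passmx.
Variables (k : fieldType) (A B : falgType k) (M : module A) (N : module B).
Variables (I J : finType).
Variables (c : I -> 'Hom(M, N)) (x : J -> 'Hom(N, M)) (y : I -> J -> A).

(** No functor is set up over the extension field [K]. Instead [M] and [N] are linked by finitely
    many linear maps satisfying identities that survive base change as matrix identities. A stable
    [U] in [M] generates [U'] in [N]; if [U'] is zero so is [U], and if [U'] is full then the [x j]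
    carry it into [U], so [U] is full by [sum1]. *)
Lemma absolutely_irreducible_transfer :
    (0 < \dim {:M})%N ->
    (forall b i j, exists a, (x j \o (mact N b \o c i))%VF = mact M a) ->
    (\sum_i \sum_j (mact M (y i j) \o (x j \o c i)) = \1)%VF ->
  absolutely_irreducible N -> absolutely_irreducible M.
Proof.
move=> M0 xbc sum1 Nirr K iota; split=> // U UA.
have [N0 Nsub] := Nirr K iota.
pose eM := vbasis {:M}; pose eN := vbasis {:N}.
have eMb : basis_of {:M} eM := vbasisP _.
have eNb : basis_of {:N} eN := vbasisP _.
pose C i := map_mx iota (mxof eM eN (c i)).
pose X j := map_mx iota (mxof eN eM (x j)).
pose a_ a := map_mx iota (act_mx M a).
pose b_ b := map_mx iota (act_mx N b).
have CbX b i j : exists a, C i *m b_ b *m X j = a_ a.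
  have [a ha] := xbc b i j; exists a.
  by rewrite /C /b_ /X /a_ -!map_mxM /= -!mxof_comp // ha.
have one : \sum_i \sum_j (C i *m X j *m a_ (y i j)) = 1%:M.
  pose mo (f : 'End(M)) := map_mx iota (mxof eM eM f).
  have moD : {morph mo : f g / f + g} by move=> f g; rewrite /mo linearD map_mxD.
  have mo0 : mo 0 = 0 by rewrite /mo linear0 map_mx0.
  have <- : mo \1%VF = 1%:M by rewrite /mo mxof1 ?map_mx1 ?(basis_free eMb).
  rewrite -sum1 (big_morph mo moD mo0); apply: eq_bigr => i _.
  rewrite (big_morph mo moD mo0); apply: eq_bigr => j _.
  by rewrite /mo /C /X /a_ -!map_mxM /= -!mxof_comp.
pose eB := vbasis {:B}.
(* A basis of [B] suffices, since the action is linear in [b]; this keeps the sum finite. The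
   [genmx] brackets make the summands square. *)
pose U' := (\sum_i \sum_(s < \dim {:B}) <<U *m (C i *m b_ eB`_s)>>)%MS.
have b_lin u b b' : b_ (u *: b + b') = iota u *: b_ b + b_ b'.
  by rewrite /b_ /act_mx mact_linear linearP map_mxD map_mxZ.
have b_sub b i : (U *m (C i *m b_ b) <= U')%MS.
  rewrite (coord_vbasis (memvf b)).
  elim/big_rec: _ => [|s v _ IH].
    have -> : b_ 0 = 0 by rewrite /b_ /act_mx mact0 linear0 map_mx0.
    by rewrite !mulmx0 sub0mx.
  rewrite b_lin !mulmxDr addmx_sub // -!scalemxAr scalemx_sub //.
  by rewrite (sumsmx_sup i) // (sumsmx_sup s) // genmxE.
have bM b b' : b_ b *m b_ b' = b_ (b' * b).
  by rewrite /b_ /act_mx mactM (mxof_comp _ _ eNb) // map_mxM.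
have U'B b : (U' *m b_ b <= U')%MS.
  rewrite sumsmxMr; apply/sumsmx_subP => i _.
  rewrite sumsmxMr; apply/sumsmx_subP => s _.
  by rewrite (eqmxMr _ (genmxE _)) -!mulmxA bM b_sub.
have U'X j : (U' *m X j <= U)%MS.
  rewrite sumsmxMr_gen; apply/sumsmx_subP => i _.
  rewrite genmxE sumsmxMr_gen; apply/sumsmx_subP => s _.
  by have [a ha] := CbX eB`_s i j; rewrite genmxE (eqmxMr _ (genmxE _)) -mulmxA ha UA.
have b1 : b_ 1 = 1%:M.
  by rewrite /b_ /act_mx mact1 mxof1 ?map_mx1 ?(basis_free eNb).
have UC i : (U *m C i <= U')%MS by have := b_sub 1 i; rewrite b1 mulmx1.
have [U'0|U'f] := Nsub _ U'B; [left | right].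
  rewrite -[U]mulmx1 -one !linear_sum big1 // => i _.
  rewrite linear_sum big1 // => j _ /=.
  have UC0 : U *m C i = 0 by apply/eqP; rewrite -submx0 -U'0.
  by rewrite !mulmxA UC0 !mul0mx.
rewrite -sub1mx -one.
apply: summx_sub => i _; apply: summx_sub => j _.
apply: submx_trans (UA (y i j)); apply: submxMr.
apply: submx_trans (submxMl _ _) _; apply: submx_trans (U'X j).
by rewrite -[X j in X in (X <= _)%MS]mul1mx submxMr // sub1mx.
Qed.

End AbsolutelyIrreducible.

Lemma split_algebra_mx (k : fieldType) (A B : falgType k)
    (r : mxrep A B) (t : mxrep B A)
    (X : 'I_(mxdim t) -> 'I_(mxdim r) -> A) (Y : 'I_(mxdim r) -> 'I_(mxdim t) -> A) :
  exact_equivalence (mxfunctor r) (mxfunctor t) -> mxcontext t r X Y ->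
  split_algebra B -> split_algebra A.
Proof.
move=> FG ctx Bs M Mi; have Ni := irreducible_fobj (exact_equivalence_sym FG) Mi.
have := Bs _ Ni; pose N := mxmod t M.
(* Followed by the coordinate [l] of [N], [c i] is the action of [X l i]; the sum hypothesis then
   becomes [\sum_i \sum_l Y i l * X l i = 1]. *)
pose c i : 'Hom(M, N) := (mxcoord N i \o mxunit_lfun ctx M)%VF.
apply: (@absolutely_irreducible_transfer _ _ _ _ _ _ _ c (mxcoord M) (fun i l => Y i l)).
- by rewrite lt0n dimv_eq0; apply/eqP; case: Mi.
- move=> b i l; exists (\sum_h t l h b * X h i); apply/lfunP=> x.
  rewrite comp_lfunE comp_lfunE -[LHS]/(mxcoord M l (mact (mxmod t M) b (c i x))).
  rewrite mxcoord_act mact_sum; apply: eq_bigr => h _.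
  by rewrite /c comp_lfunE mxunit_lfunE (mxcoord2_unit ctx) mactM comp_lfunE.
apply/lfunP=> x; rewrite id_lfunE sum_lfunE -[RHS](mact_context ctx).
apply: eq_bigr => i _; rewrite sum_lfunE; apply: eq_bigr => l _.
by rewrite !comp_lfunE mxunit_lfunE (mxcoord2_unit ctx).
Qed.

(** * Semisimplicity *)

Section Semisimple.
Variables (k : fieldType) (A : falgType k).
Implicit Types M N : module A.

(** Semisimplicity without directness: this version passes to images and to [mxsub], and directness
    is recovered at the end by discarding summands. *)
Definition sum_of_simples M (U : {vspace M}) : Prop :=
  exists s : seq {vspace M},
    (forall W, W \in s -> simple_submodule W) /\ U = (\sum_(W <- s) W)%VS.

Lemma sum_of_simples_add M (U V : {vspace M}) :
  sum_of_simples U -> sum_of_simples V -> sum_of_simples (U + V)%VS.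
Proof.
move=> [s [ss ->]] [s' [ss' ->]]; exists (s ++ s'); rewrite big_cat; split=> //.
by move=> W; rewrite mem_cat => /orP[/ss|/ss'].
Qed.

Lemma sum_of_simples0 M : sum_of_simples (0%VS : {vspace M}).
Proof. by exists [::]; rewrite big_nil. Qed.

Lemma sum_of_simples1 M (U : {vspace M}) :
  simple_submodule U -> sum_of_simples U.
Proof.
by exists [:: U]; rewrite big_seq1; split=> // W; rewrite inE => /eqP->.
Qed.

Lemma sum_of_simples_limg M N (f : mor M N) (U : {vspace M}) :
  sum_of_simples U -> sum_of_simples (f @: U)%VS.
Proof.
move=> [s [ss ->]]; rewrite limg_sum; elim: s ss => [|W s IH] ss.
  by rewrite big_nil; apply: sum_of_simples0.
rewrite big_cons; apply: sum_of_simples_add; last first.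
  by apply: IH => V Vs; apply: ss; rewrite inE Vs orbT.
have /simple_submodule_obj[S [i [Si iI <-]]] := ss W (mem_head _ _).
rewrite -[(f @: limg i)%VS]limg_comp -[(f \o i)%VF]/(mfun (compm f i)).
have [K0|Kf] := proj2 Si _ (submodule_lker (compm f i)).
  exact/sum_of_simples1/simple_submodule_limg.
have /eqP-> : limg (compm f i) == 0%VS by rewrite -lkerE Kf.
exact: sum_of_simples0.
Qed.

Lemma sum_of_simples_semisimple M :
  sum_of_simples (fullv : {vspace M}) -> semisimple M.
Proof.
move=> [s [ss sM]].
have [s' [ss' s'M /eqP s'd]] : exists s' : seq {vspace M},
    [/\ forall W, W \in s' -> simple_submodule W,
        (\sum_(W <- s') W = \sum_(W <- s) W)%VS &
        \dim (\sum_(W <- s') W)%VS = (\sum_(W <- s') \dim W)%N].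
  elim: s ss {sM} => [|W s IH] ss; first by exists [::]; rewrite !big_nil dimv0.
  have [|s' [ss' s's s'd]] := IH.
    by move=> V Vs; apply: ss; rewrite inE Vs orbT.
  have [Ws _ Wm] := ss W (mem_head _ _).
  (* As [W] is simple, this intersection is zero, and [W] is kept, or all of [W], and [W] is
     redundant. *)
  have Is : submodule (W :&: \sum_(V <- s') V)%VS.
    move=> a m; rewrite !memv_cap => /andP[mW ms]; rewrite Ws //=.
    elim: s' m {mW s's s'd} ss' ms => [|V s' IH'] m ss' ms.
      by move: ms; rewrite big_nil memv0 => /eqP->; rewrite linear0 mem0v.
    move: ms; rewrite !big_cons => /memv_addP[u uV [v vs ->]].
    rewrite linearD memv_add //; last first.
      by apply: IH' => // V' V's; apply: ss'; rewrite inE V's orbT.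
    by have [Vs _ _] := ss' V (mem_head _ _); apply: Vs.
  have [I0|IW] := Wm _ Is (capvSl _ _).
    exists (W :: s'); split.
    - by move=> V; rewrite inE => /orP[/eqP->|/ss'//]; apply: ss (mem_head _ _).
    - by rewrite !big_cons s's.
    - by rewrite !big_cons dimv_disjoint_sum // s'd.
  exists s'; split=> //; rewrite big_cons -s's.
  by apply/eqP; rewrite eqEsubv addvSr subv_add subvv -IW capvSr.
exists (size s'), (fun i => nth 0%VS s' i); split=> [i||].
- by apply/ss'/mem_nth.
- rewrite directvE /= -(big_mkord xpredT (fun i => nth 0%VS s' i)).
  rewrite -(big_mkord xpredT (fun i => \dim (nth 0%VS s' i))).
  by rewrite -(big_nth 0%VS xpredT id) -(big_nth 0%VS xpredT (fun W => \dim W)).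
by rewrite -(big_mkord xpredT (fun i => nth 0%VS s' i)) -(big_nth 0%VS xpredT id) s'M.
Qed.

Lemma semisimple_sum_of_simples M :
  semisimple M -> sum_of_simples (fullv : {vspace M}).
Proof.
move=> [n [S [Ss _ <-]]]; elim/big_rec: _ => [|i U _ IH].
  exact: sum_of_simples0.
exact/sum_of_simples_add/IH/sum_of_simples1.
Qed.

Lemma semisimple_algebra_sum_of_simples M :
  semisimple_algebra A -> sum_of_simples (fullv : {vspace M}).
Proof.
move=> /semisimple_sum_of_simples As.
have -> : fullv = (\sum_(x <- vbasis {:M}) limg (orbit_mor x))%VS :> {vspace M}.
  apply/vspaceP=> x; rewrite memvf (coord_vbasis (memvf x)); apply/esym.
  apply: memv_suml => i _; apply: memvZ.
  have ei : (vbasis {:M})`_i \in vbasis {:M} by rewrite mem_nth ?size_tuple.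
  rewrite (big_rem _ ei) /=; apply: (subvP (addvSl _ _)).
  apply/memv_imgP; exists 1; rewrite ?memvf // orbit_morE mact1.
  by rewrite id_lfunE.
elim/big_rec: _ => [|x U _ IH]; first exact: sum_of_simples0.
by apply: sum_of_simples_add IH; apply: sum_of_simples_limg.
Qed.

End Semisimple.

Section SemisimpleTransfer.
Variables (k : fieldType) (A B : falgType k) (r : mxrep A B) (t : mxrep B A).
Hypothesis FG : exact_equivalence (mxfunctor r) (mxfunctor t).

Lemma simple_submodule_mxsub (M : module B) (U : {vspace M}) :
  simple_submodule U -> simple_submodule (mxsub r U).
Proof.
move=> /simple_submodule_obj[S [i [Si iI <-]]]; rewrite -limg_mxmor.
have [[Flin Fex] _ _ _] := FG.
apply: (@simple_submodule_limg _ _ _ _ (fmor (mxfunctor r) i)).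
  exact: (irreducible_fobj FG Si).
exact: (inj_fmor Flin Fex iI).
Qed.

Lemma mxsub_add (M : module B) (U V : {vspace M}) :
  submodule U -> submodule V -> (mxsub r (U + V) <= mxsub r U + mxsub r V)%VS.
Proof.
move=> Us Vs; apply/subvP=> x /mem_mxsub xUV.
(* The coordinatewise splittings need not be fixed by the matrix of 1. Applying [mxmk] to both parts
   repairs this and leaves their sum [x] unchanged; stability of [U] and [V] keeps the parts in
   place. *)
have -> : x = mxmk (fun i => addv_pi1 U V (mxcoord M i x)) +
              mxmk (fun i => addv_pi2 U V (mxcoord M i x)).
  apply: mxcoord_inj => i; rewrite linearD /= !mxcoord_mk -big_split -[LHS]mxcoord_act1.
  by apply: eq_bigr => j _; rewrite /= -linearD /= addv_pi1_pi2.
by apply: memv_add; apply/mem_mxsub => i; rewrite mxcoord_mk;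
  apply: memv_suml => j _; [apply/Us/memv_pi1 | apply/Vs/memv_pi2].
Qed.

Lemma submodule_sum (M : module B) (s : seq {vspace M}) :
  (forall W, W \in s -> submodule W) -> submodule (\sum_(W <- s) W)%VS.
Proof.
elim: s => [|W s IH] ss a m.
  by rewrite big_nil memv0 => /eqP->; rewrite linear0 mem0v.
rewrite !big_cons => /memv_addP[u uW [v vs ->]]; rewrite linearD memv_add //.
  exact: ss (mem_head _ _) _ _ uW.
by apply: IH vs => V Vs; apply: ss; rewrite inE Vs orbT.
Qed.

Lemma sum_of_simples_mxsub (M : module B) (U : {vspace M}) :
  sum_of_simples U -> sum_of_simples (mxsub r U).
Proof.
move=> [s [ss ->]]; exists [seq mxsub r W | W <- s]; split.
  by move=> _ /mapP[W /ss Ws ->]; apply: simple_submodule_mxsub.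
have subs (V W : {vspace M}) : (V <= W)%VS -> (mxsub r V <= mxsub r W)%VS.
  move=> VW; apply/subvP=> x /mem_mxsub xV; apply/mem_mxsub => i.
  exact: (subvP VW).
apply/eqP; rewrite eqEsubv big_map; apply/andP; split; last first.
  rewrite [X in (X <= _)%VS]big_seq; elim/big_rec: _ => [|W V Ws IH]; first exact: sub0v.
  by rewrite subv_add IH andbT subs // (big_rem _ Ws) addvSl.
elim: s ss => [|W s IH] ss.
  rewrite !big_nil; apply/subvP=> x /mem_mxsub x0; rewrite memv0; apply/eqP.
  by apply: mxcoord_inj => i; rewrite linear0; apply/eqP; rewrite -memv0.
have ss' V : V \in s -> simple_submodule V.
  by move=> Vs; apply: ss; rewrite inE Vs orbT.
rewrite !big_cons; apply: subv_trans (addvS (subvv _) (IH ss')).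
apply: mxsub_add; first by case: (ss W (mem_head _ _)).
by apply: submodule_sum => V /ss'[].
Qed.

End SemisimpleTransfer.

(** The regular module of [A] need not come from that of [B], so it is written as [F] of some
    [B]-module, and over a semisimple [B] every module is a sum of simples. *)
Lemma semisimple_algebra_mx (k : fieldType) (A B : falgType k)
    (r : mxrep A B) (t : mxrep B A) :
  exact_equivalence (mxfunctor r) (mxfunctor t) ->
  semisimple_algebra B -> semisimple_algebra A.
Proof.
move=> FG /semisimple_algebra_sum_of_simples Bs.
have [e eI] := equivalence_counit FG (regular A).
apply: sum_of_simples_semisimple; rewrite -(iso_surj eI).
apply: sum_of_simples_limg; rewrite -[fullv](mxsub_full r).
exact/(sum_of_simples_mxsub FG).
Qed.

(** * Transfer of graded properties *)

Section GradedModules.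
Variables (k : fieldType) (A : falgType k) (G : pos_grading A).
Implicit Types M N : grmodule G.

Lemma linear_module_iso M N :
  isomorphic M N -> linear_module M -> linear_module N.
Proof. by move=> [f fP] [P Ph]; exists (proj_resolution_iso P fP). Qed.

Lemma graded_isomorphic M N (f : 'Hom(M, N)) (g : 'Hom(N, M)) :
    is_modmor f -> cancel f g -> cancel g f ->
    (forall i x, x \in ggr M i -> f x \in ggr N i) ->
    (forall i y, y \in ggr N i -> g y \in ggr M i) ->
  isomorphic M N.
Proof.
move=> fP fK gK fgr ggr'.
have gP : is_modmor g by move=> a y; rewrite -[y in LHS]gK -fP fK.
have fG : is_grmor f.
  by split=> // i; apply/subvP=> _ /memv_imgP[x xi ->]; apply: fgr.
have gG : is_grmor g.
  by split=> // i; apply/subvP=> _ /memv_imgP[x xi ->]; apply: ggr'.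
exists (@Mor k (grmodcat G) M N f fG), (@Mor k (grmodcat G) N M g gG).
by split; apply: mor_eq; apply/lfunP=> x; rewrite comp_lfunE id_lfunE.
Qed.

Definition in_grade0 M : Prop :=
  forall i, ggr M i = if i == 0 then fullv else 0%VS.

Lemma in_grade0_isomorphic M N (f : 'Hom(M, N)) (g : 'Hom(N, M)) :
    in_grade0 M -> in_grade0 N ->
    is_modmor f -> cancel f g -> cancel g f -> isomorphic M N.
Proof.
move=> M0 N0 fP fK gK; apply: graded_isomorphic fP fK gK _ _ => i x;
  rewrite M0 N0; case: eqP => _; rewrite ?memvf // !memv0 => /eqP->;
  by rewrite linear0.
Qed.

Lemma val_infl_comp0 M a (x : infl (comp0 M)) :
  vsval (mact (infl (comp0 M)) a x) = mact M (pr0 G a) (vsval x).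
Proof.
rewrite /= /infl_act /= /comp0_act !comp_lfunE lfun_vsprojE lfun_vsvalE ?val_to_A0 //.
by apply: act0_gr; [apply: pr0_mem | apply: subvsP].
Qed.

End GradedModules.

Section GradedTransfer.
Variables (k : fieldType) (A B : falgType k) (r : mxrep A B) (t : mxrep B A).
Variables (GA : pos_grading A) (GB : pos_grading B).
Hypotheses (rG : mxgraded GA GB r) (tG : mxgraded GB GA t).
Local Notation F := (mxgrfunctor rG).
Hypothesis FG : exact_equivalence (mxfunctor r) (mxfunctor t).
Hypothesis FGgr : exact_equivalence F (mxgrfunctor tG).

Lemma linear_module_mx (M : grmodule GB) : linear_module M -> linear_module (F M).
Proof.
move=> [P Ph]; exists (proj_resolution_fobj FGgr P) => n j jn.
exact: (sub_rad_mx FG (Ph n j jn)).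
Qed.

Lemma colinear_module_mx (M : grmodule GB) :
  colinear_module M -> colinear_module (F M).
Proof.
move=> [P Ph]; exists (inj_resolution_fobj FGgr P) => n.
exact: (soc_sub_mx FG (Ph n)).
Qed.

Lemma graded_qh_mx (d : Order.disp_t) (Lam : finPOrderType d)
    (D N : Lam -> grmodule GB) :
  graded_qh D N -> graded_qh (fun lam => F (D lam)) (fun lam => F (N lam)).
Proof.
move=> [[L [Li LD LN]] hs]; split; last first.
  move=> lam; split=> [j j0|]; first exact: (sub_rad_mx FG ((hs lam).1 j j0)).
  exact: (soc_sub_mx FG (hs lam).2).
exists (fun lam => mxfunctor r (L lam)); split.
- exact: (irr_index_mx FG Li).
- exact: (standard_family_mx FG LD).
- exact: (costandard_family_mx FG LN).
Qed.

(** Shifting only renumbers the grades, and [F] builds grades coordinatewise, so the identity map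
    serves as the natural isomorphism. *)
Lemma mxgrfunctor_graded : graded_functor F.
Proof.
split=> [M N f g|j].
  by have [[Flin _] _ _ _] := FGgr; apply: Flin.
have P (M : grmodule GB) :
    @is_grmor k A GA (mxgrmod rG (shift j M)) (shift j (mxgrmod rG M)) \1%VF.
  exact: (@is_grmor_id k A GA (mxgrmod rG (shift j M))).
exists (fun M => @Mor k (grmodcat GA) (mxgrmod rG (shift j M)) (shift j (mxgrmod rG M)) _ (P M)).
split=> [M|M N f].
  exists (@Mor k (grmodcat GA) (shift j (mxgrmod rG M)) (mxgrmod rG (shift j M)) _ (P M)).
  by split; apply: mor_eq; apply/lfunP=> x; rewrite comp_lfunE !id_lfunE.
by apply: mor_eq; apply/lfunP=> x; rewrite !comp_lfunE !id_lfunE.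
Qed.

Lemma shift_mx j (M : grmodule GB) : isomorphic (F (shift j M)) (shift j (F M)).
Proof.
have [_ /(_ j)[eta [etaI _]]] := mxgrfunctor_graded.
by exists (eta M); apply: etaI.
Qed.

Lemma shift_iso j (M N : grmodule GA) :
  isomorphic M N -> isomorphic (shift j M) (shift j N).
Proof. exact: (isomorphic_fobj (shift_functor GA j)). Qed.

Lemma ext_neq0_shift_mx n j (M N : grmodule GB) (M' N' : grmodule GA) :
  isomorphic M' (F M) -> isomorphic N' (F N) ->
  ext_neq0 n M' (shift j N') -> ext_neq0 n M (shift j N).
Proof.
move=> MM NN; move/(ext_neq0_iso MM (shift_iso j NN)).
move/(ext_neq0_iso (isomorphic_refl _) (isomorphic_sym (shift_mx j N))).
exact: (ext_neq0_equivalence FGgr).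
Qed.

(** A homogeneous representation commutes with reduction to grade 0, so its restriction [mxrep0] is
    compatible with inflation along [to_A0]. *)
Lemma mxent_pr0 i j a : r i j (pr0 GA a) = pr0 GB (r i j a).
Proof.
move: a; apply: (decomposition_ind (agr_dec GA)) => [n a an||a b aE bE].
- case: (posnP n) => [n0|n0]; last first.
    by rewrite (pr0_posg n0 an) (pr0_posg n0 (rG i j an)) linear0.
  by rewrite n0 in an; rewrite (pr0_id an) (pr0_id (rG i j an)).
- by rewrite !linear0.
- by rewrite !linearD /= aE bE.
Qed.

Definition mxent0 i j : 'Hom(subvs_of (A0 GA), subvs_of (A0 GB)) :=
  (linfun (vsproj (A0 GB)) \o r i j \o linfun vsval)%VF.

Lemma val_mxent0 i j a : vsval (mxent0 i j a) = r i j (vsval a).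
Proof.
rewrite /mxent0 comp_lfunE lfun_vsvalE comp_lfunE lfun_vsprojE //.
exact: (rG i j (subvsP a)).
Qed.

Fact mxent0M a b i j :
  mxent0 i j (a * b) = \sum_l mxent0 i l a * mxent0 l j b.
Proof.
apply: subvs_inj; rewrite val_mxent0 mxentM linear_sum; apply: eq_bigr => l _.
by rewrite /= !val_mxent0.
Qed.

Definition mxrep0 : mxrep (subvs_of (A0 GA)) (subvs_of (A0 GB)) :=
  MxRep mxent0M.

Lemma to_A0_mxent i j a : to_A0 GB (r i j a) = mxrep0 i j (to_A0 GA a).
Proof. by apply: subvs_inj; rewrite val_mxent0 !val_to_A0 mxent_pr0. Qed.

Lemma in_grade0_mx (M : grmodule GB) : in_grade0 M -> in_grade0 (F M).
Proof.
move=> M0 i; rewrite -[LHS]/(mxsub r (ggr M i)) M0; case: eqP => _.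
  exact: mxsub_full.
apply/eqP; rewrite -subv0; apply/subvP=> x /mem_mxsub x0; rewrite memv0.
apply/eqP/mxcoord_inj => j; rewrite linear0; apply/eqP; rewrite -memv0.
exact: x0.
Qed.

(** Both sides are the tuples in [D] fixed by the same idempotent, read once over [A_0] and once
    over [A]. The types differ, so the isomorphism copies coordinates. *)
Lemma infl_mx (D : module (subvs_of (A0 GB))) :
  isomorphic (infl (mxfunctor mxrep0 D)) (F (infl D)).
Proof.
pose f0 (x : mxmod mxrep0 D) : mxmod r (infl D) :=
  @mxmk _ _ _ r (infl D) (fun i => @mxcoord _ _ _ mxrep0 D i x).
pose g0 (x : mxmod r (infl D)) : mxmod mxrep0 D :=
  @mxmk _ _ _ mxrep0 D (fun i => @mxcoord _ _ _ r (infl D) i x).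
have r1 i j : to_A0 GB (r i j 1) = mxrep0 i j 1 by rewrite to_A0_mxent to_A01.
have f0E x i : mxcoord (infl D) i (f0 x) = @mxcoord _ _ _ mxrep0 D i x.
  rewrite mxcoord_mk -[RHS](mxcoord_act1 (r := mxrep0)); apply: eq_bigr => j _.
  by rewrite -r1.
have g0E x i : @mxcoord _ _ _ mxrep0 D i (g0 x) = mxcoord (infl D) i x.
  rewrite mxcoord_mk -[RHS](mxcoord_act1 (r := r)); apply: eq_bigr => j _.
  by rewrite -r1.
have fl : linear f0.
  by move=> c x y; apply: mxcoord_inj => i; rewrite [RHS]linearP /= !f0E linearP.
have gl : linear g0.
  by move=> c x y; apply: mxcoord_inj => i; rewrite [RHS]linearP /= !g0E linearP.
apply: (@in_grade0_isomorphic _ _ GA (infl (mxmod mxrep0 D)) (F (infl D))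
  (lin_lfun fl) (lin_lfun gl)) => //.
- exact: in_grade0_mx.
- move=> a x; rewrite !(lin_lfunE fl); apply: mxcoord_inj => i.
  rewrite mxcoord_act f0E [LHS](mxcoord_act (r := mxrep0)); apply: eq_bigr => j _.
  by rewrite f0E -to_A0_mxent.
- by move=> x; rewrite lin_lfunE (lin_lfunE fl); apply: mxcoord_inj => i; rewrite g0E f0E.
- by move=> x; rewrite lin_lfunE (lin_lfunE gl); apply: mxcoord_inj => i; rewrite f0E g0E.
Qed.

(** Grade 0 of [F N] consists of the tuples with all coordinates in grade 0 of [N]. This handles the
    modules in grade 0 that occur in the standard Q-Koszul conditions. *)
Lemma infl_comp0_mx (N : grmodule GB) :
  isomorphic (infl (comp0 (F N))) (F (infl (comp0 N))).
Proof.
pose N0 := infl (comp0 N).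
pose f0 (x : comp0 (mxgrmod rG N)) : mxmod r N0 :=
  @mxmk _ _ _ r N0 (fun i => vsproj (ggr N 0) (mxcoord N i (vsval x))).
pose g0 (x : mxmod r N0) : comp0 (mxgrmod rG N) :=
  vsproj (ggr (mxgrmod rG N) 0) (mxmk (fun i => vsval (mxcoord N0 i x))).
have act1E i j (y : N0) : vsval (mact N0 (r i j 1) y) = mact N (r i j 1) (vsval y).
  by rewrite val_infl_comp0 pr0_id //; apply/rG/agr_one.
have f0E x i : vsval (mxcoord N0 i (f0 x)) = mxcoord N i (vsval x).
  rewrite mxcoord_mk linear_sum -[RHS]mxcoord_act1; apply: eq_bigr => j _.
  rewrite [LHS]act1E vsprojK //.
  by have /mem_mxsub := subvsP x; apply.
have g0E y i : mxcoord N i (vsval (g0 y)) = vsval (mxcoord N0 i y).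
  have mkE j : mxcoord N j (mxmk (fun i => vsval (mxcoord N0 i y))) =
      vsval (mxcoord N0 j y).
    rewrite mxcoord_mk -[in RHS]mxcoord_act1 linear_sum; apply: eq_bigr => l _.
    by rewrite [RHS]act1E.
  rewrite vsprojK ?mkE //; apply/mem_mxsub => j; rewrite mkE; apply: subvsP.
have fl : linear f0.
  move=> c x y; apply: mxcoord_inj => i; apply: subvs_inj.
  rewrite f0E [in RHS]linearP [RHS](vsval_is_linear (U := ggr N 0)).
  by rewrite /= !f0E linearP.
have gl : linear g0.
  move=> c x y; apply: subvs_inj; apply: mxcoord_inj => i.
  by rewrite g0E linearP /= linearP /= !g0E.
apply: (@in_grade0_isomorphic _ _ GA (infl (comp0 (mxgrmod rG N))) (F N0)
  (lin_lfun fl) (lin_lfun gl)) => //.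
- exact: in_grade0_mx.
- move=> a x; rewrite !(lin_lfunE fl); apply: mxcoord_inj => i.
  apply: subvs_inj; rewrite mxcoord_act f0E.
  rewrite val_infl_comp0 [LHS]mxcoord_act linear_sum; apply: eq_bigr => j _.
  by rewrite [RHS]val_infl_comp0 f0E mxent_pr0.
- move=> x; rewrite lin_lfunE (lin_lfunE fl); apply: subvs_inj.
  by apply: mxcoord_inj => i; rewrite g0E f0E.
- move=> x; rewrite lin_lfunE (lin_lfunE gl); apply: mxcoord_inj => i.
  by apply: subvs_inj; rewrite f0E g0E.
Qed.

(** Semisimplicity is transferred by the context between [A_0] and [B_0]. A simple [M] in grade 0
    is, up to graded isomorphism, [F] of its image under the inverse functor, which is again simple
    and in grade 0. *)
Lemma koszul_mx (t0 : mxrep _ _) :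
    exact_equivalence (mxfunctor mxrep0) (mxfunctor t0) ->
  koszul GB -> koszul GA.
Proof.
move=> FG0 [Bss Blin]; split; first exact: semisimple_algebra_mx FG0 Bss.
move=> M Mi M0; apply: linear_module_iso (equivalence_counit FGgr M) _.
apply: linear_module_mx; apply: Blin.
  exact: (irreducible_fobj (exact_equivalence_sym FG) Mi).
by rewrite /concentrated -[LHS]/(mxsub t (ggr M 0)) M0 mxsub_full.
Qed.

Lemma standard_koszul_mx (t0 : mxrep _ _) :
    exact_equivalence (mxfunctor mxrep0) (mxfunctor t0) ->
  standard_koszul GB -> standard_koszul GA.
Proof.
move=> FG0 [Bk [d [Lam [D [N [DN DNl]]]]]]; split; first exact: koszul_mx FG0 Bk.
exists d, Lam, (fun lam => F (D lam)), (fun lam => F (N lam)).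
split=> [|lam]; first exact: graded_qh_mx.
split; first exact: linear_module_mx (DNl lam).1.
exact: colinear_module_mx (DNl lam).2.
Qed.

Lemma q_koszul_mx (t0 : mxrep _ _) :
    exact_equivalence (mxfunctor mxrep0) (mxfunctor t0) ->
    (split_algebra B -> split_algebra A) ->
  q_koszul GB -> q_koszul GA.
Proof.
move=> FG0 spl [/spl As [d [Lam [L [D [N [Li LD LN ext]]]]]]]; split=> //.
exists d, Lam, (fun lam => mxfunctor mxrep0 (L lam)),
  (fun lam => mxfunctor mxrep0 (D lam)), (fun lam => mxfunctor mxrep0 (N lam)).
split.
- exact: (irr_index_mx FG0 Li).
- exact: (standard_family_mx FG0 LD).
- exact: (costandard_family_mx FG0 LN).
move=> i j lam mu i0 extA; apply: (ext i j lam mu i0).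
exact: ext_neq0_shift_mx (infl_mx _) (infl_mx _) extA.
Qed.

Lemma standard_q_koszul_mx :
    (split_algebra B -> split_algebra A) ->
  standard_q_koszul GB -> standard_q_koszul GA.
Proof.
move=> spl [/spl As [d [Lam [D [N [DN ext]]]]]]; split=> //.
exists d, Lam, (fun lam => F (D lam)), (fun lam => F (N lam)).
split=> [|n j lam mu]; first exact: graded_qh_mx.
have [e1 e2] := ext n j lam mu; split=> extA.
  apply: e1; apply: ext_neq0_shift_mx (isomorphic_refl _) (infl_comp0_mx _) extA.
by apply: e2; apply: ext_neq0_shift_mx (infl_comp0_mx _) (isomorphic_refl _) extA.
Qed.

End GradedTransfer.

Section ContextZero.
Variables (k : fieldType) (A B : falgType k) (r : mxrep A B) (t : mxrep B A).
Variables (GA : pos_grading A) (GB : pos_grading B).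
Hypotheses (rG : mxgraded GA GB r) (tG : mxgraded GB GA t).
Variables (X : 'I_(mxdim r) -> 'I_(mxdim t) -> B).
Variables (Y : 'I_(mxdim t) -> 'I_(mxdim r) -> B).
Hypotheses (X0 : forall i l, X i l \in agr GB 0).
Hypotheses (Y0 : forall l i, Y l i \in agr GB 0).

(** As [X] and [Y] have grade 0, the context restricts to one between [A_0] and [B_0]. Conditions on
    [A_0] itself, such as semisimplicity or quasi-heredity, are transferred through it. *)
Lemma mxcontext0 : mxcontext r t X Y ->
  mxcontext (mxrep0 rG) (mxrep0 tG)
    (fun i l => vsproj (A0 GB) (X i l)) (fun l i => vsproj (A0 GB) (Y l i)).
Proof.
move=> [XY YX]; split=> [b l h i j|].
  apply: subvs_inj; rewrite (val_mxent0 rG).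
  have -> : vsval (mxrep0 tG l h b) = t l h (vsval b) := val_mxent0 tG l h b.
  by rewrite XY /= !vsprojK.
apply: subvs_inj; rewrite linear_sum [RHS]algid_A0 -YX; apply: eq_bigr => l _.
by rewrite /= linear_sum; apply: eq_bigr => i _; rewrite /= !vsprojK.
Qed.

End ContextZero.

Section GradedMorita.
Variables (k : fieldType) (A B : falgType k) (r : mxrep A B) (t : mxrep B A).
Variables (X : 'I_(mxdim r) -> 'I_(mxdim t) -> B).
Variables (Y : 'I_(mxdim t) -> 'I_(mxdim r) -> B).
Variables (X' : 'I_(mxdim t) -> 'I_(mxdim r) -> A).
Variables (Y' : 'I_(mxdim r) -> 'I_(mxdim t) -> A).
Hypotheses (ctxB : mxcontext r t X Y) (ctxA : mxcontext t r X' Y').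

Lemma mxcontext_equivalence : exact_equivalence (mxfunctor r) (mxfunctor t).
Proof.
split; [exact: mxfunctor_exact | exact: mxfunctor_exact | |].
  exact: mxcounit_nat_iso ctxB.
exact: mxcounit_nat_iso ctxA.
Qed.

Section Graded.
Variables (GA : pos_grading A) (GB : pos_grading B).
Hypotheses (rG : mxgraded GA GB r) (tG : mxgraded GB GA t).
Hypotheses (X0 : forall i l, X i l \in agr GB 0).
Hypotheses (Y0 : forall l i, Y l i \in agr GB 0).
Hypotheses (X'0 : forall l i, X' l i \in agr GA 0).
Hypotheses (Y'0 : forall i l, Y' i l \in agr GA 0).

Lemma mxcontext_graded_equivalence :
  exact_equivalence (mxgrfunctor rG) (mxgrfunctor tG).
Proof.
split; [exact: mxgrfunctor_exact | exact: mxgrfunctor_exact | |].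
  exact: mxcounit_nat_iso_graded ctxB _ _ _ _ X0 Y0.
exact: mxcounit_nat_iso_graded ctxA _ _ _ _ X'0 Y'0.
Qed.

End Graded.
End GradedMorita.

(** * Graded Morita contexts from Morita equivalences *)

Section MoritaData.
Variables (k : fieldType) (A B : falgType k).
Variables (F : functor (modcat A) (modcat B)) (G : functor (modcat B) (modcat A)).
Hypothesis Flin : linear_functor F.
Hypothesis GFid : nat_iso (comp_functor G F) (id_functor (modcat A)).
Hypothesis FGid : nat_iso (comp_functor F G) (id_functor (modcat B)).
Local Notation P := (F (regular A)).

Lemma faithful_zero X Y (f : mor X Y) : mfun (fmor F f) = 0 -> mfun f = 0.
Proof.
move=> f0; suff -> : f = linm (-1) f f by rewrite /= scaleN1r addNr.
by apply: (nat_iso_faithful GFid); rewrite Flin; apply: mor_eq; rewrite /= f0 scaler0 addr0.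
Qed.

(* The trace ideal of P is B: a map p out of B that vanishes on it satisfies
   G(p) = 0, as every element of G(B) lies in the image of a map A -> G(B). *)
Lemma generator_dual : exists (m : nat) (g : 'I_m -> mor P (regular B)) (p : 'I_m -> P),
  \sum_l g l (p l) = 1.
Proof.
have [eta [etaI etaN]] := FGid.
have [||m [x [xQ x1]]] := @sum_eq1 k B (fun b =>
  exists (g : mor P (regular B)) (p : P), b = g p).
- by move=> a _ [g [p ->]]; exists g, (mact P a p); rewrite (morP g) regular_actE.
- move=> C p p0; have G0 : mfun (fmor G p) = 0.
    apply/lfunP=> y; rewrite zero_lfunE.
    have : mfun (compm (fmor G p) (orbit_mor y)) = 0.
      apply: faithful_zero; rewrite fmor_comp.
      have inj := proj1 (inj_morP _) (iso_inj (etaI C)).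
      apply/lfunP=> q; apply: inj; rewrite zero_lfunE linear0.
      have /(congr1 (fun h => mfun h (fmor F (orbit_mor y) q))) := etaN _ _ p.
      rewrite /= !comp_lfunE => ->.
      apply: p0; exists (compm (eta (regular B)) (fmor F (orbit_mor y))), q.
      by rewrite /= comp_lfunE.
    by move/lfunP/(_ 1); rewrite zero_lfunE /= comp_lfunE orbit_morE mact1 id_lfunE.
  have FG0 := fmor_zero Flin G0; apply/lfunP=> b; rewrite zero_lfunE.
  have /surj_morP/(_ b)[v ->] := iso_surj (etaI (regular B)).
  have /(congr1 (fun h => mfun h v)) := etaN _ _ p.
  by rewrite /= !comp_lfunE FG0 zero_lfunE linear0 => <-.
have /fin_all_exists2 : forall i, exists2 gp : mor P (regular B) * P, True &
    x i = gp.1 gp.2.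
  by move=> i; have [g [p E]] := xQ i; exists (g, p).
case=> gp _ gpE; exists m, (fun i => (gp i).1), (fun i => (gp i).2).
by rewrite -x1; apply: eq_bigr.
Qed.

(** The elements [a] for which [F] of right multiplication by [a] factors through [B] form the set
    fed to [sum_eq1]. If [p] kills them, any [q] in [P] gives a map from [B] to [P], which up to
    [eta] is [F] of some [w] with values in this set; hence [p w = 0], so [fmor F p] kills [q].
    Writing 1 as a sum of such elements factors the identity of [P] through a power of [B]. *)
Lemma projective_dual : exists (n : nat) (f : 'I_n -> mor P (regular B)) (p : 'I_n -> P),
  forall x : P, x = \sum_j mact P (f j x : B) (p j).
Proof.
have [eta [etaI etaN]] := FGid.
have [||n [x [xQ x1]]] := @sum_eq1 k A (fun a => exists (f : mor P (regular B)) (p : P),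
    fmor F (orbit_mor (a : regular A)) = compm (orbit_mor p) f).
- move=> a b [f [p E]]; exists (compm f (fmor F (orbit_mor (a : regular A)))), p.
  by rewrite compmA -E -fmor_comp orbit_mor_comp orbit_morE regular_actE.
- move=> C p p0; apply: faithful_zero; apply/lfunP=> q; rewrite zero_lfunE.
  have [w wE] := @nat_iso_full k _ _ F G (G (regular B)) (regular A)
    (compm (orbit_mor q) (eta (regular B))) GFid FGid.
  have pw : mfun (compm p w) = 0.
    apply/lfunP=> y; rewrite zero_lfunE /= comp_lfunE; apply: p0.
    exists (compm (eta (regular B)) (fmor F (orbit_mor y))), q.
    by rewrite compmA -wE -fmor_comp orbit_mor_comp.
  have := fmor_zero Flin pw; rewrite fmor_comp wE.
  have /surj_morP/(_ 1)[v vE] := iso_surj (etaI (regular B)).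
  move/lfunP/(_ v); rewrite zero_lfunE /= !comp_lfunE -vE orbit_morE.
  by rewrite mact1 id_lfunE.
have /fin_all_exists2 : forall i, exists2 fp : mor P (regular B) * P, True &
    fmor F (orbit_mor (x i : regular A)) = compm (orbit_mor fp.2) fp.1.
  by move=> i; have [f [p E]] := xQ i; exists (f, p).
case=> fp _ fpE; exists n, (fun i => (fp i).1), (fun i => (fp i).2) => y.
have th_sum (s : seq 'I_n) :
    mfun (fmor F (orbit_mor (\sum_(i <- s) x i : regular A))) =
    \sum_(i <- s) mfun (fmor F (orbit_mor (x i : regular A))).
  elim: s => [|i s IH].
    rewrite !big_nil; apply: (fmor_zero Flin); apply/lfunP=> c.
    by rewrite orbit_morE linear0 zero_lfunE.
  rewrite !big_cons -IH.
  by rewrite -[x i in LHS]scale1r orbit_mor_linear Flin /= scale1r.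
have := th_sum (index_enum _); rewrite x1.
rewrite orbit_mor_id.
rewrite fmor_id => /lfunP/(_ y); rewrite /= id_lfunE => yE.
rewrite [LHS]yE sum_lfunE; apply: eq_bigr => i _.
by rewrite fpE /= comp_lfunE orbit_morE.
Qed.

End MoritaData.

(* A is isomorphic, via rho, to the corner e M_n(B) e with e = rho 1, and e is
   full: the last condition puts 1 in the trace ideal of e. *)
Record full_corner (k : fieldType) (A B : falgType k) n m
    (rho : A -> 'M[B]_n) (S : 'M[B]_(m, n)) (T : 'M[B]_(n, m)) : Prop := FullCorner {
  corner_linear : forall i j, linear (fun a => rho a i j);
  cornerM : forall a b, rho (a * b) = rho a *m rho b;
  corner_inj : injective rho;
  corner_onto : forall X, rho 1 *m X *m rho 1 = X -> exists a, rho a = X;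
  corner_full : \sum_l (S *m rho 1 *m T) l l = 1
}.

(** [rho a] is the matrix of [th a] on the generators [p i], written in rows. [th] reverses
    products, and the row convention reverses them again. [S] expresses the [q l] through the [p j],
    and [T] holds the values of the [g l] on the [p j]. *)
Lemma morita_full_corner (k : fieldType) (A B : falgType k) :
  morita_equivalent A B -> exists n m rho S T, @full_corner k A B n m rho S T.
Proof.
move=> [F [Flin [G [GFid FGid]]]].
have [m [g [q gq]]] := generator_dual Flin GFid FGid.
have [n [f [p fp]]] := projective_dual Flin GFid FGid.
pose th (a : A) := fmor F (orbit_mor (a : regular A)).
have fM j b x : f j (mact (F (regular A)) b x) = b * f j x.
  by rewrite (morP (f j)) regular_actE.
have gM j b x : g j (mact (F (regular A)) b x) = b * g j x.
  by rewrite (morP (g j)) regular_actE.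
have thL c a b x : th (c *: a + b) x = c *: th a x + th b x.
  have -> : th (c *: a + b) = linm c (th a) (th b).
    by rewrite /th -Flin -orbit_mor_linear.
  by rewrite /= add_lfunE scale_lfunE.
have thM a b x : th (a * b) x = th b (th a x).
  have -> : th (a * b) = compm (th b) (th a).
    by rewrite /th -fmor_comp orbit_mor_comp orbit_morE regular_actE.
  by rewrite /= comp_lfunE.
have th1 x : th 1 x = x.
  have -> : th 1 = idm (F (regular A)).
    by rewrite /th orbit_mor_id fmor_id.
  by rewrite /= id_lfunE.
exists n, m, (fun a => \matrix_(i, j) f j (th a (p i))),
  (\matrix_(l, j) f j (q l)), (\matrix_(j, l) g l (p j)); split.
- by move=> i j c a b; rewrite !mxE thL linearP.
- move=> a b; apply/matrixP=> i j; rewrite !mxE thM [th a (p i)]fp !linear_sum.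
  by apply: eq_bigr => l _; rewrite !mxE /= (morP (th b)) fM.
- move=> a b /matrixP ab.
  have thp i : th a (p i) = th b (p i).
    by rewrite [LHS]fp [RHS]fp; apply: eq_bigr => j _; have := ab i j; rewrite !mxE => ->.
  have thab : th a = th b.
    apply: mor_eq; apply/lfunP=> x; rewrite (fp x) !linear_sum.
    by apply: eq_bigr => j _; rewrite /= (morP (th a)) (morP (th b)) thp.
  have := nat_iso_faithful GFid thab.
  move/(congr1 (fun h : mor (regular A) (regular A) => mfun h 1)).
  by rewrite !orbit_morE !mact1 !id_lfunE.
- move=> X XE.
  (* The endomorphism of [P] with matrix [X]; fullness of [F] turns it into right multiplication by
     some [w 1] in [A]. *)
  have hl : linear (fun x : F (regular A) =>
      \sum_i \sum_j mact (F (regular A)) (f i x * X i j : B) (p j)).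
    move=> c x y; rewrite scaler_sumr -big_split; apply: eq_bigr => i _.
    rewrite scaler_sumr -big_split; apply: eq_bigr => j _.
    by rewrite linearP mulrDl -scalerAl mact_linear add_lfunE scale_lfunE.
  have hP : is_modmor (lin_lfun hl).
    move=> b x; rewrite !(lin_lfunE hl) linear_sum; apply: eq_bigr => i _.
    rewrite linear_sum; apply: eq_bigr => j _.
    by rewrite /= fM -mulrA mactM comp_lfunE.
  have [w wE] := @nat_iso_full k _ _ F G (regular A) (regular A)
    (@Mor k (modcat B) (F (regular A)) (F (regular A)) _ hP) GFid FGid.
  exists (w 1); rewrite -XE; apply/matrixP=> i j; rewrite /th -orbit_mor1 wE !mxE.
  rewrite (lin_lfunE hl) linear_sum.
  under eq_bigr => u _ do rewrite linear_sum.
  rewrite exchange_big; apply: eq_bigr => v _; rewrite !mxE mulr_suml.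
  by apply: eq_bigr => u _; rewrite !mxE !th1 /= fM.
have -> : \sum_(l < m) ((\matrix_(l, j) f j (q l)) *m
    (\matrix_(i, j) f j (th 1 (p i))) *m (\matrix_(j, l) g l (p j))) l l
  = \sum_l g l (q l); last exact: gq.
apply: eq_bigr => l _; rewrite !mxE [q l in RHS]fp linear_sum.
apply: eq_bigr => j _; rewrite !mxE /= gM; congr (_ * _).
rewrite [q l in RHS]fp linear_sum; apply: eq_bigr => i _.
by rewrite !mxE th1 /= fM.
Qed.

(** * Moving the idempotent into grade 0 *)

Section LiftIdempotent.
Variables (k : fieldType) (B : falgType k) (GB : pos_grading B).

Local Notation p0 := (map_mx (pr0 GB)).

Lemma map_pr0M m n p (X : 'M[B]_(m, n)) (Y : 'M[B]_(n, p)) :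
  p0 (X *m Y) = p0 X *m p0 Y.
Proof.
apply/matrixP=> i j; rewrite !mxE linear_sum; apply: eq_bigr => l _.
by rewrite !mxE /= pr0M.
Qed.

Lemma map_pr0D m n (X Y : 'M[B]_(m, n)) : p0 (X + Y) = p0 X + p0 Y.
Proof. by apply/matrixP=> i j; rewrite !mxE linearD. Qed.

Lemma map_pr0B m n (X Y : 'M[B]_(m, n)) : p0 (X - Y) = p0 X - p0 Y.
Proof. by apply/matrixP=> i j; rewrite !mxE linearB. Qed.

Lemma map_pr01 n : p0 1%:M = 1%:M :> 'M[B]_n.
Proof.
by apply/matrixP=> i j; rewrite !mxE; case: eqP; rewrite ?pr01 ?linear0.
Qed.

Lemma map_pr0_id m n (X : 'M[B]_(m, n)) : p0 (p0 X) = p0 X.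
Proof. by apply/matrixP=> i j; rewrite !mxE pr0_id ?pr0_mem. Qed.

(* 1 - u has entries in B_(>0), which is nilpotent. *)
Lemma pr0_eq1_unit n (u : 'M[B]_n) : p0 u = 1%:M ->
  exists u' : 'M[B]_n, u *m u' = 1%:M /\ u' *m u = 1%:M.
Proof.
move=> u1; have [pi [s P]] := decomposition_projections (agr_dec GB).
have [pm pid po psum] := P.
have pi0 b : pi 0%N b = pr0 GB b.
  move: b; apply: (decomposition_ind (agr_dec GB)) => [d b bd||b c bE cE].
  - have [d0|d0] := posnP d; first by rewrite d0 in bd; rewrite pid ?pr0_id.
    by rewrite (po _ _ _ bd) -?lt0n // (pr0_posg d0 bd).
  - by rewrite !linear0.
  - by rewrite !linearD /= bE cE.
(* The filtration by components of grade at least [q], expressed through the projections. *)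
pose fil q (b : B) := forall d, (d < q)%N -> pi d b = 0.
have filM q b c : fil q b -> fil 1%N c -> fil q.+1 (b * c).
  move=> bq c1 d dq; rewrite (psum b) (psum c) mulr_suml linear_sum big1 // => i _.
  rewrite mulr_sumr linear_sum big1 // => j _ /=.
  have [iq|qi] := ltnP i q; first by rewrite bq // mul0r linear0.
  have [j0|j0] := posnP j; first by rewrite j0 c1 // mulr0 linear0.
  apply: (po d (i + j)%N); first by apply: agrM; apply: pm.
  by rewrite gtn_eqF // (leq_trans dq) // -addn1 leq_add.
pose N := 1 - u.
have N1 i j : fil 1%N (N i j).
  move=> d; rewrite ltnS leqn0 => /eqP->; rewrite pi0.
  have : p0 N = 0 by rewrite /N map_pr0B u1 map_pr01 subrr.
  by move/matrixP/(_ i j); rewrite !mxE.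
have Nq q i j : fil q ((N ^+ q) i j).
  elim: q i j => [|q IH] i j; first by [].
  rewrite exprSr -[_ * _]/(_ *m _) mxE => d dq; rewrite linear_sum big1 // => l _.
  exact: filM (IH i l) (N1 l j) _ dq.
have [q Nq0] : exists q, N ^+ q = 0.
  (* This exponent exceeds every grade in the finite list [s], so no component of the power
     survives. *)
  exists (\sum_(d <- s) d).+1; apply/matrixP=> i j; rewrite [RHS]mxE (psum (_ i j)).
  rewrite big_seq big1 // => d ds; apply: (Nq _ i j).
  by rewrite ltnS (big_rem _ ds) leq_addr.
have uE : u = 1 - N by rewrite /N opprB addrC subrK.
have comN : GRing.comm u (\sum_(i < q) N ^+ i).
  apply: commr_sum => i _; apply: commrX; rewrite uE.
  by apply: commr_sym; apply: commrB; [apply: commr1 | apply: commr_refl].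
have uS : u * (\sum_(i < q) N ^+ i) = 1.
  by apply: oppr_inj; rewrite -mulNr uE opprB -subrX1 Nq0 sub0r.
by exists (\sum_(i < q) N ^+ i); split; [exact: uS | rewrite -[LHS]comN].
Qed.

(** [u] is the usual intertwiner of the two idempotents: [E u = E (p0 E) = u (p0 E)]. Its grade 0
    part is 1, so it is invertible. *)
Lemma idempotent_conj_pr0 n (E : 'M[B]_n) : E *m E = E ->
  exists u u' : 'M[B]_n,
    [/\ u *m u' = 1%:M, u' *m u = 1%:M & u' *m E *m u = p0 E].
Proof.
move=> EE; have E0E0 : p0 E *m p0 E = p0 E by rewrite -map_pr0M EE.
pose u := E *m p0 E + (1%:M - E) *m (1%:M - p0 E).
have [|u' [uu' u'u]] := @pr0_eq1_unit _ u.
  rewrite map_pr0D !map_pr0M !map_pr0B !map_pr0_id map_pr01 E0E0.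
  by rewrite mulmxBl !mulmxBr !mul1mx mulmx1 E0E0 subrr subr0 addrC subrK.
exists u, u'; split=> //.
have Eu : E *m u = E *m p0 E.
  by rewrite mulmxDr !mulmxA EE [E *m (_ - _)]mulmxBr mulmx1 EE subrr mul0mx addr0.
have uE : u *m p0 E = E *m p0 E.
  rewrite mulmxDl -!mulmxA E0E0 [(_ - _) *m p0 E]mulmxBl mul1mx E0E0 subrr.
  by rewrite mulmx0 addr0.
by rewrite -mulmxA Eu -uE mulmxA u'u mul1mx.
Qed.

End LiftIdempotent.

Lemma graded_full_corner (k : fieldType) (A B : falgType k) (GB : pos_grading B)
    n m (rho : A -> 'M[B]_n) (S : 'M[B]_(m, n)) (T : 'M[B]_(n, m)) :
  full_corner rho S T ->
  exists rho' S' T', [/\ @full_corner k A B n m rho' S' T',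
    forall i j, rho' 1 i j \in agr GB 0, forall l i, S' l i \in agr GB 0 &
    forall i l, T' i l \in agr GB 0].
Proof.
move=> [rl rM rinj ronto rfull]; set E := rho 1.
have EE : E *m E = E by rewrite -rM mulr1.
have [u [u' [uu' u'u uE]]] := idempotent_conj_pr0 GB EE.
have u'K p (X : 'M[B]_(n, p)) : u' *m (u *m X) = X by rewrite mulmxA u'u mul1mx.
have uK p (X : 'M[B]_(n, p)) : u *m (u' *m X) = X by rewrite mulmxA uu' mul1mx.
exists (fun a => u' *m rho a *m u), (map_mx (pr0 GB) (S *m u)),
  (map_mx (pr0 GB) (u' *m T)).
split; [split| | |].
- move=> i j c a b; rewrite !mxE scaler_sumr -big_split; apply: eq_bigr => l _.
  rewrite /= !mxE scalerAl -mulrDl; congr (_ * _); rewrite scaler_sumr -big_split.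
  by apply: eq_bigr => v _; rewrite /= rl mulrDr -scalerAr.
- by move=> a b; rewrite rM -!mulmxA uK.
- move=> a b ab; apply: rinj; have := congr1 (fun X => u *m X *m u') ab.
  by rewrite -!mulmxA !uK uu' !mulmx1.
- move=> X XE; have [|a aE] := ronto (u *m X *m u').
    by rewrite -[in RHS]XE -/E -!mulmxA !uK uu' mulmx1.
  by exists a; rewrite aE -!mulmxA u'u mulmx1 u'K.
(* Since [pr0] is multiplicative, it may be applied to the old fullness identity after inserting
   [u u' = 1]; [S] and [T] may thus be cut down to grade 0. *)
- transitivity (pr0 GB (\sum_l (S *m E *m T) l l)); last by rewrite rfull pr01.
  rewrite linear_sum -/E uE; apply: eq_bigr => l _.
  rewrite -[X in _ *m X *m _]map_pr0_id -!map_pr0M -uE mxE.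
  by rewrite -!mulmxA !uK.
- by move=> i j; rewrite -/E uE mxE pr0_mem.
- by move=> l i; rewrite mxE pr0_mem.
- by move=> i l; rewrite mxE pr0_mem.
Qed.

(** [corner_onto] gives preimages only one at a time; the linear pseudo-inverse provides them as a
    function. *)
Lemma full_corner_inverse (k : fieldType) (A B : falgType k) n m
    (rho : A -> 'M[B]_n) (S : 'M[B]_(m, n)) (T : 'M[B]_(n, m)) :
  full_corner rho S T ->
  exists kappa : 'M[B]_n -> A,
    forall X, rho 1 *m X *m rho 1 = X -> rho (kappa X) = X.
Proof.
move=> [rl rM rinj ronto _].
have Rl : linear (fun a =>
    [ffun ij : 'I_n * 'I_n => rho a ij.1 ij.2] : {ffun 'I_n * 'I_n -> B}).
  by move=> c a b; apply/ffunP=> ij; rewrite !ffunE rl.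
pose R := lin_lfun Rl; exists (fun X => (R^-1)%VF [ffun ij => X ij.1 ij.2]).
move=> X /ronto[a <-]; apply/matrixP=> i j.
have := limg_lfunVK (memv_img R (memvf a)); rewrite !(lin_lfunE Rl).
by move/ffunP/(_ (i, j)); rewrite !ffunE.
Qed.

(** * The graded context of a corner whose idempotent has grade 0 *)

Section GradedContext.
Variables (k : fieldType) (A B : falgType k) (GB : pos_grading B) (n m : nat).
Variables (rho : A -> 'M[B]_n) (S : 'M[B]_(m, n)) (T : 'M[B]_(n, m)).
Hypothesis corner : full_corner rho S T.
Hypothesis rho10 : forall i j, rho 1 i j \in agr GB 0.
Hypothesis S0 : forall l i, S l i \in agr GB 0.
Hypothesis T0 : forall i l, T i l \in agr GB 0.

Let ent i j : 'Hom(A, B) := lin_lfun (corner_linear corner i j).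
Let entE i j a : ent i j a = rho a i j. Proof. exact: lin_lfunE. Qed.
Let e := rho 1.
Let ee : e *m e = e. Proof. by rewrite -(cornerM corner) mulr1. Qed.
Let erho a : e *m rho a = rho a. Proof. by rewrite -(cornerM corner) mul1r. Qed.
Let rhoe a : rho a *m e = rho a. Proof. by rewrite -(cornerM corner) mulr1. Qed.

Definition corner_gr (d : nat) : {vspace A} :=
  (\bigcap_i \bigcap_j (ent i j @^-1: agr GB d))%VS.

Lemma mem_corner_gr d a :
  reflect (forall i j, rho a i j \in agr GB d) (a \in corner_gr d).
Proof.
rewrite memvE; apply: (iffP subv_bigcapP) => [H i j|H i _].
  by have /subv_bigcapP/(_ j isT) := H i isT; rewrite -memvE -memv_preim entE.
by apply/subv_bigcapP => j _; rewrite -memvE -memv_preim entE.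
Qed.

Lemma projections_mul0 pi s d b x : projections (agr GB) pi s ->
  b \in agr GB 0 -> pi d (b * x) = b * pi d x /\ pi d (x * b) = pi d x * b.
Proof.
move=> [pm pid po _] b0; move: x; apply: (decomposition_ind (agr_dec GB)).
- move=> j x xj.
  have bx : b * x \in agr GB j by have := agrM b0 xj; rewrite add0n.
  have xb : x * b \in agr GB j by have := agrM xj b0; rewrite addn0.
  have [->|dj] := eqVneq d j; first by rewrite !pid.
  have jd : j != d by rewrite eq_sym.
  by rewrite (po _ _ _ bx) // (po _ _ _ xb) // (po _ _ _ xj) // mulr0 mul0r.
- by rewrite mulr0 mul0r !linear0 mulr0 mul0r.
- move=> x y [xl xr] [yl yr]; rewrite mulrDr mulrDl !linearD /= xl xr yl yr.
  by rewrite mulrDr mulrDl.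
Qed.

(** The idempotent [e] has grade 0, so the entrywise projections of [B] commute with multiplication
    by [e]. They map the corner to itself, and [kappa] carries them back to [A]. *)
Lemma corner_gr_dec : decomposition corner_gr.
Proof.
have [pi [s P]] := decomposition_projections (agr_dec GB).
have [pm pid po psum] := P; have [kappa kP] := full_corner_inverse corner.
have eX d X : map_mx (pi d) (e *m X) = e *m map_mx (pi d) X.
  apply/matrixP=> i j; rewrite !mxE linear_sum; apply: eq_bigr => v _.
  by rewrite !mxE /= (projections_mul0 _ _ P _).1.
have Xe d X : map_mx (pi d) (X *m e) = map_mx (pi d) X *m e.
  apply/matrixP=> i j; rewrite !mxE linear_sum; apply: eq_bigr => v _.
  by rewrite !mxE /= (projections_mul0 _ _ P _).2.
have piE d a : rho (kappa (map_mx (pi d) (rho a))) = map_mx (pi d) (rho a).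
  by apply: kP; rewrite -eX -Xe erho rhoe.
have ql d : linear (fun a => kappa (map_mx (pi d) (rho a))).
  move=> c a b; apply: (corner_inj corner); apply/matrixP=> i j.
  by rewrite piE mxE !(corner_linear corner) !piE !mxE linearP.
have qE d a i j : rho (lin_lfun (ql d) a) i j = pi d (rho a i j).
  by rewrite (lin_lfunE (ql d)) piE mxE.
apply: (@projections_decomposition _ _ _ _ (fun d => lin_lfun (ql d)) s).
split=> [d a|d a /mem_corner_gr ad|d d' a /mem_corner_gr ad dd'|a].
- by apply/mem_corner_gr => i j; rewrite qE.
- by apply: (corner_inj corner); apply/matrixP=> i j; rewrite qE pid.
- apply: (corner_inj corner); apply/matrixP=> i j.
  by rewrite qE (po d d') // -[in RHS]entE linear0.
apply: (corner_inj corner); apply/matrixP=> i j.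
rewrite -[RHS]entE linear_sum [LHS]psum; apply: eq_bigr => d _.
by rewrite /= entE qE.
Qed.

Fact corner_grM i j a b :
  a \in corner_gr i -> b \in corner_gr j -> a * b \in corner_gr (i + j)%N.
Proof.
move=> /mem_corner_gr ai /mem_corner_gr bj; apply/mem_corner_gr => u v.
by rewrite (cornerM corner) mxE; apply: memv_suml => l _; apply: agrM.
Qed.

Definition corner_grading : pos_grading A := PosGrading corner_gr_dec corner_grM.

Fact corner_entM a b i j : ent i j (a * b) = \sum_l ent i l a * ent l j b.
Proof.
rewrite entE (cornerM corner) mxE; apply: eq_bigr => l _.
by rewrite !entE.
Qed.

Definition corner_rep : mxrep A B := MxRep corner_entM.

Lemma mulmx_gr0 p q l (X : 'M[B]_(p, q)) (Y : 'M[B]_(q, l)) :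
    (forall i j, X i j \in agr GB 0) -> (forall i j, Y i j \in agr GB 0) ->
  forall i j, (X *m Y) i j \in agr GB 0.
Proof.
move=> X0 Y0 i j; rewrite mxE; apply: memv_suml => v _.
by have := agrM (X0 i v) (Y0 v j).
Qed.

(** After this replacement the rows of [S'] and the columns of [T'] are fixed by [e]; the fullness
    identity persists because [e] is idempotent. *)
Let S' := S *m e.
Let T' := e *m T.
Let S'0 l i : S' l i \in agr GB 0. Proof. exact: mulmx_gr0. Qed.
Let T'0 i l : T' i l \in agr GB 0. Proof. exact: mulmx_gr0. Qed.
Let S'e : S' *m e = S'. Proof. by rewrite /S' -mulmxA ee. Qed.
Let eT' : e *m T' = T'. Proof. by rewrite /T' mulmxA ee. Qed.
Let ST1 : \sum_l \sum_i S' l i * T' i l = 1.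
Proof.
rewrite -(corner_full corner); apply: eq_bigr => l _.
by rewrite -/e -ee -!mulmxA [in RHS]mulmxA [RHS]mxE.
Qed.

(* In bimodule terms P = B^n e is generated by the rows of e and
   Hom_B(P, B) = e B^n by its columns, both in grade 0. *)
Lemma graded_context :
  exists (GA : pos_grading A) (r : mxrep A B) (t : mxrep B A) X Y X' Y',
    [/\ mxcontext r t X Y, mxcontext t r X' Y', mxgraded GA GB r,
        mxgraded GB GA t &
        [/\ forall i l, X i l \in agr GB 0, forall l i, Y l i \in agr GB 0,
            forall l i, X' l i \in agr GA 0 & forall i l, Y' i l \in agr GA 0]].
Proof.
move: (S'0) (T'0) (S'e) (eT') ST1; move: (S') (T') => U V U0 V0 Ue eV UV1.
have [kappa kP] := full_corner_inverse corner; rewrite -/e in kP.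
(* A column fixed by [e], a scalar and a row fixed by [e] multiply to an element of the corner. The
   entries of the new representation, [X'] and [Y'] are all of this shape, with columns taken from
   [V] or [e] and rows from [U] or [e]. *)
pose cr (u : 'cV[B]_n) (b : B) (v : 'rV[B]_n) : 'M[B]_n :=
  \matrix_(i, j) (u i 0 * b * v 0 j).
have crE (u : 'cV[B]_n) b (v : 'rV[B]_n) : cr u b v = u *m (b%:M *m v).
  apply/matrixP=> i j; rewrite !mxE big_ord1 !mxE big_ord1 mxE eqxx mulr1n.
  by rewrite mulrA.
have kcr u b v : e *m u = u -> v *m e = v -> rho (kappa (cr u b v)) = cr u b v.
  by move=> eu ve; apply: kP; rewrite !crE mulmxA eu -!mulmxA ve.
have eT l : e *m col l V = col l V by rewrite !colE mulmxA eV.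
have Se l : row l U *m e = row l U by rewrite -row_mul Ue.
have ec j : e *m col j e = col j e by rewrite !colE mulmxA ee.
have re i : row i e *m e = row i e by rewrite -row_mul ee.
pose tau l h b := kappa (cr (col l V) b (row h U)).
have tauE l h b i j : rho (tau l h b) i j = V i l * b * U h j.
  by rewrite kcr // !mxE.
have taul l h : linear (tau l h).
  move=> c a b; apply: (corner_inj corner); apply/matrixP=> i j.
  by rewrite (corner_linear corner) !tauE mulrDr mulrDl -scalerAr -scalerAl.
pose t_ent l h : 'Hom(B, A) := lin_lfun (taul l h).
have tE l h b i j : rho (t_ent l h b) i j = V i l * b * U h j.
  by rewrite (lin_lfunE (taul l h)) tauE.
have rhoD (I : finType) (F : I -> A) i j : rho (\sum_x F x) i j = \sum_x rho (F x) i j.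
  by rewrite -entE linear_sum; apply: eq_bigr => x _; rewrite /= entE.
have tM a b l h : t_ent l h (a * b) = \sum_v t_ent l v a * t_ent v h b.
  apply: (corner_inj corner); apply/matrixP=> i j; rewrite tE rhoD.
  rewrite -[a in LHS]mulr1 -UV1 mulr_sumr mulr_suml mulr_sumr mulr_suml.
  apply: eq_bigr => v _; rewrite (cornerM corner) mxE.
  rewrite mulr_sumr mulr_suml mulr_sumr mulr_suml.
  by apply: eq_bigr => u _; rewrite !tE !mulrA.
pose X' l i := kappa (cr (col l V) 1 (row i e)).
pose Y' j h := kappa (cr (col j e) 1 (row h U)).
have X'E l i u v : rho (X' l i) u v = V u l * e i v by rewrite kcr // !mxE mulr1.
have Y'E j h u v : rho (Y' j h) u v = e u j * U h v by rewrite kcr // !mxE mulr1.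
exists corner_grading, corner_rep, (MxRep tM).
exists (fun i l => V i l), (fun l i => U l i), X', Y'; split.
- by split=> [b l h i j|//]; rewrite /= entE tE.
- split=> [a i j l h|].
    apply: (corner_inj corner); apply/matrixP=> u v.
    rewrite tE !(cornerM corner) mxE /= entE.
    (* Expanding [a] as [e a e] produces the entries of [e] that occur in [X'] and [Y']. *)
    have aE : rho a i j = \sum_x \sum_y e i y * rho a y x * e x j.
      rewrite -[in LHS](rhoe a) -[in LHS](erho a) mxE; apply: eq_bigr => x _.
      by rewrite mxE mulr_suml.
    rewrite aE mulr_sumr mulr_suml; apply: eq_bigr => x _; rewrite mxE Y'E.
    rewrite mulr_sumr !mulr_suml; apply: eq_bigr => y _.
    by rewrite X'E !mulrA.
  apply: (corner_inj corner); apply/matrixP=> u v; rewrite rhoD -/e -[in RHS]ee mxE.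
  apply: eq_bigr => i _; rewrite rhoD -[e u i in RHS]mulr1 -UV1 mulr_sumr mulr_suml.
  apply: eq_bigr => l _; rewrite (cornerM corner) mxE mulr_sumr mulr_suml.
  by apply: eq_bigr => w _; rewrite Y'E X'E !mulrA.
- by move=> i j d a /mem_corner_gr ad; rewrite /= entE.
- move=> l h d b bd; apply/mem_corner_gr => i j; rewrite /= tE.
  have := agrM (V0 i l) bd; rewrite add0n => Tb.
  by have := agrM Tb (U0 h j); rewrite addn0.
split=> // [l i|i l]; apply/mem_corner_gr => u v.
  by rewrite X'E; have := agrM (V0 u l) (rho10 i v).
by rewrite Y'E; have := agrM (rho10 u i) (U0 l v).
Qed.

End GradedContext.

Lemma morita_graded_context (k : fieldType) (A B : falgType k) (GB : pos_grading B) :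
  morita_equivalent A B ->
  exists (GA : pos_grading A) (r : mxrep A B) (t : mxrep B A) X Y X' Y',
    [/\ mxcontext r t X Y, mxcontext t r X' Y', mxgraded GA GB r,
        mxgraded GB GA t &
        [/\ forall i l, X i l \in agr GB 0, forall l i, Y l i \in agr GB 0,
            forall l i, X' l i \in agr GA 0 & forall i l, Y' i l \in agr GA 0]].
Proof.
move=> /morita_full_corner[n [m [rho [S [T corner]]]]].
have [rho' [S' [T' [corner' r0 S0 T0]]]] := graded_full_corner GB corner.
exact: graded_context corner' r0 S0 T0.
Qed.

(** Quasi-heredity is transferred when no grading on [B] is given, while contexts are built from a
    graded [B]; concentrating [B] in grade 0 bridges the gap. *)
Lemma trivial_grading (k : fieldType) (A : falgType k) : inhabited (pos_grading A).
Proof.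
pose W (n : nat) : {vspace A} := if n == 0%N then fullv else 0%VS.
have Wdec : decomposition W.
  apply: (@projections_decomposition _ _ _ _
    (fun n => if n == 0%N then \1%VF else 0) [:: 0%N]).
  split=> [n x|n x|n m x|x].
  - by rewrite /W; case: eqP => _; rewrite ?memvf // zero_lfunE mem0v.
  - rewrite /W; case: eqP => _; first by rewrite id_lfunE.
    by rewrite memv0 => /eqP->; rewrite linear0.
  - move=> xm mn; case: eqP => [n0|_]; last by rewrite zero_lfunE.
    rewrite n0 in mn; move: xm; rewrite /W ifN // memv0 => /eqP->.
    by rewrite linear0.
  by rewrite big_seq1 id_lfunE.
constructor; apply: (PosGrading Wdec) => i j a b; rewrite /W.
have [->|_] := eqVneq i 0%N; last first.
  by rewrite memv0 => /eqP->; rewrite mul0r mem0v.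
have [_|_] := eqVneq j 0%N; first by rewrite !memvf.
by rewrite memv0 => _ /eqP->; rewrite mulr0 mem0v.
Qed.

Theorem corollary5p2 (k : fieldType) (A B : falgType k)
    (hAB : morita_equivalent A B) :
  (quasi_hereditary B -> quasi_hereditary A) /\
  (forall GB : pos_grading B, exists GA : pos_grading A,
     (koszul GB -> koszul GA) /\
     (standard_koszul GB -> standard_koszul GA) /\
     (q_koszul GB -> q_koszul GA) /\
     (standard_q_koszul GB -> standard_q_koszul GA) /\
     (exists F : functor (grmodcat GB) (grmodcat GA),
        graded_functor F /\ equivalence F)).
Proof.
split=> [|GB].
  have [GB] := trivial_grading B.
  have [_ [r [t [X [Y [X' [Y' [cB cA _ _ _]]]]]]]] := morita_graded_context GB hAB.
  exact: quasi_hereditary_mx (mxcontext_equivalence cB cA).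
have [GA [r [t [X [Y [X' [Y' [cB cA rG tG [X0 Y0 X'0 Y'0]]]]]]]]] :=
  morita_graded_context GB hAB.
have FG := mxcontext_equivalence cB cA.
have FGgr := mxcontext_graded_equivalence cB cA rG tG X0 Y0 X'0 Y'0.
have FG0 := mxcontext_equivalence (mxcontext0 rG tG X0 Y0 cB)
  (mxcontext0 tG rG X'0 Y'0 cA).
have spl := split_algebra_mx FG cA.
exists GA; split; first exact: (koszul_mx FG FGgr FG0).
split; first exact: (standard_koszul_mx FG FGgr FG0).
split; first exact: (q_koszul_mx FGgr FG0 spl).
split; first exact: (standard_q_koszul_mx FG FGgr spl).
exists (mxgrfunctor rG); split; first exact: (mxgrfunctor_graded FGgr).
by have [_ _ ni ni'] := FGgr; exists (mxgrfunctor tG).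
Qed.
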